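(* Let $s\in(0,1]$, $\lambda\in\mathbb{R}$, and let $\rho\in L^1(\mathbb{R})\cap L^\infty(\mathbb{R})\cap C^\alpha(\mathbb{R})$ be nonnegative, where $\alpha>\max(1-2s,0)$, with $\int_{\mathbb{R}}\rho\,dx=1$ and $\int_{\mathbb{R}}x^2\rho(x)\,dx<\infty$. Let $\rho_\infty$ be the minimum point of $\mathcal{E}$ on $\mathcal{P}_2(\mathbb{R})$. Then $$\mathcal{E}(\rho)-\mathcal{E}(\rho_\infty)\le \sqrt{\mathcal{I}(\rho)}\,W_2(\rho,\rho_\infty)-\frac{\lambda}{2}W_2^2(\rho,\rho_\infty).$$
   Context: $\mathcal{P}_2(\mathbb{R})$ is the set of Borel probability measures on $\mathbb{R}$ with finite second moment, and $W_2(\rho_1,\rho_2)=\big(\inf_{\pi\in\Pi(\rho_1,\rho_2)}\int_{\mathbb{R}\times\mathbb{R}}|x-y|^2d\pi(x,y)\big)^{1/2}$ is the quadratic Wasserstein distance, where $\Pi(\rho_1,\rho_2)$ is the set of nonnegative Radon measures with marginals $\rho_1,\rho_2$. Absolutely continuous measures are identified with their densities. $C^\alpha(\mathbb{R})$ is the space of (globally) H\''older continuous functions with exponent $\alpha\in(0,1]$. In dimension one, let $W(x)=c_{1,s}|x|^{2s-1}$ with $c_{1,s}=\frac{s2^{-2s}\Gamma(1/2-s)}{\pi^{1/2}\Gamma(1+s)}$ for $s\in(0,1]$, $s\ne 1/2$ (so $c_{1,s}<0$ for $s>1/2$), and $W(x)=-\frac1\pi\log|x|$ for $s=1/2$. Put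 $(-\partial_{xx})^{-s}\rho:=W*\rho$. The energy is $\mathcal{E}(\rho)=\frac12\iint_{\mathbb{R}\times\mathbb{R}}W(x-y)\,d\rho(x)d\rho(y)+\frac{\lambda}{2}\int_{\mathbb{R}}x^2\,d\rho(x)$, and the entropy dissipation is $\mathcal{I}(\rho)=\int_{\mathbb{R}}\big|\partial_x(-\partial_{xx})^{-s}\rho(x)+\lambda x\big|^2\rho(x)\,dx$. (For $\rho$ as in the claim, $(-\partial_{xx})^{-s}\rho$ is of class $C^1$.) If no minimum point of $\mathcal{E}$ on $\mathcal{P}_2(\mathbb{R})$ exists, the statement is void. *)

(* Defs.v *)
From HB Require Import structures.
From mathcomp Require Import all_boot all_order all_algebra.
From mathcomp Require Import all_classical all_reals all_analysis.
Import Order.TTheory GRing.Theory Num.Theory.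
Import numFieldNormedType.Exports.

Set Implicit Arguments.
Unset Strict Implicit.
Unset Printing Implicit Defensive.

Local Open Scope classical_set_scope.
Local Open Scope ring_scope.

Local Notation leb := lebesgue_measure (only parsing).

Section gamma.
Context {R : realType}.
Implicit Types x s : R.

Definition euler_gamma x : R :=
  \int[leb]_(t in `]0, +oo[) (t `^ (x - 1) * expR (- t)).

(* Euler's integral for x > 0, extended to x <= 0 by the functional equation
   Gamma (x + n) = x (x + 1) ... (x + n - 1) Gamma x; junk at the poles. *)
Definition Gamma x : R :=
  if 0 < x then euler_gamma x
  else let n := (Num.truncn (- x)).+1 in
       euler_gamma (x + n%:R) / \prod_(i < n) (x + i%:R).

Definition c1 s : R :=
  s * 2 `^ (- (2 * s)) * Gamma (2^-1 - s) / (pi `^ 2^-1 * Gamma (1 + s)).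

(* The kernel is extended by its limit at 0, which is +oo for s <= 1/2: this
   value matters for the energy of measures with atoms (powR and ln would give
   the junk value 0 there). *)
Definition W s x : \bar R :=
  if (s <= 2^-1) && (x == 0) then +oo%E
  else if s == 2^-1 then (- (pi^-1 * ln `|x|))%:E
  else (c1 s * `|x| `^ (2 * s - 1))%:E.

End gamma.

Section density.
Context {R : realType} (rho : R -> R).

(* rho dx as a probability measure; the proof arguments ensure that it is one *)
Definition density_prob
    (rho_L1 : leb.-integrable [set: R] (EFin \o rho))
    (rho_ge0 : forall x, 0 <= rho x)
    (rho_mass : (\int[leb]_x (rho x)%:E = 1)%E) :
    set (measurableTypeR R) -> \bar R :=
  fun A => (\int[leb]_(x in A) (rho x)%:E)%E.

Context (rho_L1 : leb.-integrable [set: R] (EFin \o rho))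
        (rho_ge0 : forall x, 0 <= rho x)
        (rho_mass : (\int[leb]_x (rho x)%:E = 1)%E).

Local Notation P := (density_prob rho_L1 rho_ge0 rho_mass).

Let density0 : P set0 = 0%E.
Proof. by rewrite /density_prob integral_set0. Qed.

Let density_ge0 A : (0 <= P A)%E.
Proof. by apply: integral_ge0 => x _; rewrite lee_fin. Qed.

Let density_sigma_additive : semi_sigma_additive P.
Proof.
move=> /= F mF tF mUF; rewrite /density_prob; apply: cvg_toP.
  apply: ereal_nondecreasing_is_cvgn => m n mn.
  apply: lee_sum_nneg_natr => // k _ _.
  by apply: integral_ge0 => /= x _; rewrite lee_fin.
rewrite ge0_integral_bigcup//=.
- by apply: (measurable_funS measurableT _ (measurable_int _ rho_L1)).
- by move=> x _; rewrite lee_fin.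
Qed.

HB.instance Definition _ := isMeasure.Build _ _ _ P
  density0 density_ge0 density_sigma_additive.

Let density_setT : P [set: _] = 1%E.
Proof. exact: rho_mass. Qed.

HB.instance Definition _ := @Measure_isProbability.Build _ _ R P density_setT.

End density.

Section wasserstein.
Context {R : realType}.
Local Notation RB := (measurableTypeR R).
Implicit Types mu nu : probability RB R.

Definition second_moment mu : \bar R := (\int[mu]_x (x ^+ 2)%:E)%E.

Definition P2 : set (probability RB R) :=
  [set mu | (second_moment mu < +oo)%E].

(* Such a measure is finite on the Polish space R^2, hence Radon. *)
Definition couplings mu nu : set {measure set (RB * RB) -> \bar R} :=
  [set g | (forall A, measurable A -> g (fst @^-1` A) = mu A) /\
           (forall B, measurable B -> g (snd @^-1` B) = nu B)].

Definition W2 mu nu : \bar R :=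
  sqrte (ereal_inf
    [set (\int[g]_z (`|z.1 - z.2| ^+ 2)%:E)%E | g in couplings mu nu]).

End wasserstein.

Section energy.
Context {R : realType} (s lambda : R).
Local Notation RB := (measurableTypeR R).

Definition energy (mu : probability RB R) : \bar R :=
  ((2^-1)%:E * \int[mu \x mu]_z W s (z.1 - z.2)%R
   + (lambda / 2)%:E * \int[mu]_x (x ^+ 2)%:E)%E.

Definition is_energy_minimizer (mu : probability RB R) : Prop :=
  P2 mu /\ forall nu, P2 nu -> (energy mu <= energy nu)%E.

(* (-d^2/dx^2)^{-s} rho = W * rho *)
Definition potential (rho : R -> R) (x : R) : R :=
  fine (\int[leb]_y (W s (x - y)%R * (rho y)%:E))%E.

Definition dissipation (rho : R -> R) : \bar R :=
  (\int[leb]_x (`|derive1 (potential rho) x + lambda * x| ^+ 2 * rho x)%:E)%E.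

End energy.

Definition holder_continuous {R : realType} (alpha : R) (f : R -> R) : Prop :=
  exists C : R, forall x y, `|f x - f y| <= C * `|x - y| `^ alpha.

(* Main.v *)
Require Import Defs.
From HB Require Import structures.
From mathcomp Require Import all_boot all_order all_algebra.
From mathcomp Require Import all_classical all_reals all_analysis.
From mathcomp Require Import measurable_realfun ring lra.
Import Order.TTheory GRing.Theory Num.Theory.
Import numFieldNormedType.Exports.
Local Open Scope classical_set_scope.
Local Open Scope ring_scope.

(* Along a monotone (comonotone) coupling (X, Y) of rho dx and rho_inf the
   differences X u - X v and Y u - Y v have the same sign, and W is even and
   convex on each half-line, so the tangent inequality
     W (Y u - Y v) >= W (X u - X v) + W' (X u - X v) ((Y u - Y v) - (X u - X v))
   may be integrated in (u, v).  As W' is odd, the last term gives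
   2 E[(W * rho)' (X) (Y - X)]; the confinement is handled exactly, and the
   Cauchy-Schwarz inequality together with the optimality of the monotone
   coupling, E[(X - Y)^2] = W2^2, concludes.
   W' is not locally integrable for s <= 1/2.  So everything is first done for
   the kernel in which W is replaced on |x| <= 2^-n by its tangent at 2^-n: this
   kernel is Lipschitz, below W, and still convex on each half-line.  Since the
   truncated W' is odd and rho is alpha-Hoelder with alpha > 1 - 2 s, the
   potentials and their derivatives converge geometrically and uniformly, which
   also shows that W * rho is differentiable. *)

Set Implicit Arguments.
Unset Strict Implicit.
Unset Printing Implicit Defensive.

(** * Truncated kernels *)

(** Both measures are realized as quantile functions of one uniform variable, so atoms of [rho_inf]
    are harmless. The tangent inequality breaks down where [X u = X v], at the kink of the kernel;
    this diagonal is null because [rho dx] has no atoms. All regimes of [W] share one profile [k]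
    with [k' r = kap r^b], [b = 2 s - 2] and [kap <= 0]: [c1 s] and [2 s - 1] have opposite signs on
    each side of [s = 1/2], and the logarithm is the case [b = -1]. Halving a cutoff [e] changes the
    kernel by order [e^(b + 1)] on a ball of mass of order [e], so the potential moves by
    [e^(b + 2) = e^(2 s)], which is summable over dyadic [e]. The derivative of the kernel changes
    by [e^b] on that ball, which alone gives [e^(2 s - 1)], not summable for [s <= 1/2]. By oddness
    [rho x] may be subtracted from [rho y]; this gains [e^alpha], and [2 s - 1 + alpha > 0] is the
    hypothesis on [alpha]. The term [- (lambda / 2) W2^2] is the remainder in
    [Y^2 = X^2 + 2 X (Y - X) + (Y - X)^2]. *)

Section truncated_profile.
Context {R : realType} (k : R -> R) (kap b : R).
Hypothesis kap_le0 : kap <= 0.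
Hypothesis b_le0 : b <= 0.
Hypothesis tangent : forall x y : R, 0 < x -> 0 < y ->
  k x + kap * x `^ b * (y - x) <= k y.
Implicit Types e x y r : R.

(* k is convex with derivative kap r^b and may be singular at 0; it is
   replaced on r <= e by its tangent at e, negative r included. *)
Definition tslope e r := kap * (Num.max r e) `^ b.

Definition tprofile e r :=
  if r <= e then k e + kap * e `^ b * (r - e) else k r.

(** As [kap <= 0] and [b <= 0], the slope is steepest on [r <= e], where it is constant; this is the
    best Lipschitz constant of [tprofile e]. *)
Definition tlip e := - (kap * e `^ b).

Definition tkernel e x := tprofile e `|x|.

(** [Num.sg 0 = 0] gives the value 0 at the kink, so that oddness holds at every point. *)
Definition tkernel' e x := Num.sg x * tslope e `|x|.

Lemma nincr_powR x y : 0 < x -> x <= y -> y `^ b <= x `^ b.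
Proof.
move=> x0 xy; have y0 := lt_le_trans x0 xy.
rewrite -[b]opprK !(powRN _ (- b)) lef_pV2 ?posrE ?powR_gt0//.
by rewrite ge0_ler_powR ?nnegrE ?oppr_ge0// ltW.
Qed.

Lemma tlip_ge0 e : 0 <= tlip e.
Proof. by rewrite oppr_ge0 mulr_le0_ge0 ?powR_ge0. Qed.

Lemma tlip_le e e' : 0 < e' -> e' <= e -> tlip e <= tlip e'.
Proof.
move=> e0 ee; rewrite lerN2 ler_wnM2l//; exact: nincr_powR.
Qed.

Lemma tslope_le0 e x : tslope e x <= 0.
Proof. by rewrite mulr_le0_ge0 ?powR_ge0. Qed.

Lemma tslope_ge e x : 0 < e -> - tlip e <= tslope e x.
Proof.
move=> e0; rewrite opprK ler_wnM2l// nincr_powR//.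
by rewrite le_max lexx orbT.
Qed.

Lemma tslope_small e x : x <= e -> tslope e x = - tlip e.
Proof. by move=> xe; rewrite /tslope /tlip opprK max_r. Qed.

Lemma tslope_big e x : e <= x -> tslope e x = kap * x `^ b.
Proof. by move=> xe; rewrite /tslope max_l. Qed.

Lemma tprofile_tangent e x y : 0 < e ->
  tprofile e x + tslope e x * (y - x) <= tprofile e y.
Proof.
move=> e0; rewrite /tprofile.
have [xe|ex] := leP x e; have [ye|ey] := leP y e.
- by rewrite tslope_small// /tlip; lra.
- rewrite tslope_small// /tlip.
  by have := tangent e0 (lt_trans e0 ey); lra.
(* The tangent at [x] is below [k] at [e]; to the left of [e] the profile climbs with the slope at
   [e], steeper than the slope at [x]. *)
- rewrite tslope_big ?(ltW ex)//.
  have h1 := tangent (lt_trans e0 ex) e0.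
  have h2 : kap * e `^ b <= kap * x `^ b.
    by rewrite ler_wnM2l// nincr_powR// ltW.
  have h3 : 0 <= (kap * x `^ b - kap * e `^ b) * (e - y).
    by rewrite mulr_ge0// subr_ge0.
  move: h1 h2 h3; set A := kap * _; set B := kap * _; lra.
- rewrite tslope_big ?(ltW ex)//.
  exact: (tangent (lt_trans e0 ex) (lt_trans e0 ey)).
Qed.

Lemma tprofile_nincr e x y : 0 < e -> x <= y -> tprofile e y <= tprofile e x.
Proof.
move=> e0 xy; apply: le_trans (tprofile_tangent y x e0).
by rewrite lerDl mulr_le0 ?tslope_le0// subr_le0.
Qed.

Lemma tprofile_lip e x y : 0 < e ->
  `|tprofile e x - tprofile e y| <= tlip e * `|x - y|.
Proof.
move=> e0; wlog xy : x y / x <= y.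
  move=> h; have [xy|yx] := leP x y; first exact: h.
  by rewrite distrC (distrC x); apply/h/ltW.
rewrite ger0_norm ?subr_ge0 ?tprofile_nincr//.
rewrite ler0_norm ?subr_le0//.
have h1 := tprofile_tangent x y e0.
have : - tlip e * (y - x) <= tslope e x * (y - x).
  by rewrite ler_wpM2r ?subr_ge0// tslope_ge.
lra.
Qed.

(** On [r <= e] the left-hand side is the tangent of the convex [tprofile e'] at [e]; beyond [e]
    both profiles are [k]. *)
Lemma tprofile_le e e' r : 0 < e' -> e' <= e -> tprofile e r <= tprofile e' r.
Proof.
move=> e0 ee; have [re|er] := leP r e; last first.
  by rewrite /tprofile !ifN// -ltNge// (le_lt_trans ee).
have := tprofile_tangent e r e0; rewrite tslope_big//.
have [<-//|e'e] := eqVneq e e'.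
have {}e'e : e' < e by rewrite lt_neqAle eq_sym e'e.
by rewrite {1}/tprofile (leNgt e) e'e/= [tprofile e r]/tprofile re.
Qed.

Lemma tprofile_le_profile e r : 0 < e -> 0 < r -> tprofile e r <= k r.
Proof.
by move=> e0 r0; rewrite /tprofile; case: ifPn => // _; exact: tangent.
Qed.

Lemma tprofile_big e r : e < r -> tprofile e r = k r.
Proof. by move=> er; rewrite /tprofile leNgt er. Qed.

Lemma tkernel'N e x : tkernel' e (- x) = - tkernel' e x.
Proof. by rewrite /tkernel' normrN sgrN mulNr. Qed.

Lemma tkernel_lip e x y : 0 < e ->
  `|tkernel e x - tkernel e y| <= tlip e * `|x - y|.
Proof.
move=> e0; apply: le_trans (tprofile_lip _ _ e0) _.
by rewrite ler_wpM2l ?tlip_ge0// ler_dist_dist.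
Qed.

Lemma tkernel'_le e x : 0 < e -> `|tkernel' e x| <= tlip e.
Proof.
move=> e0; rewrite normrM (ler0_norm (tslope_le0 _ _)).
have h := tslope_ge `|x| e0.
rewrite normr_sg; case: (x == 0); rewrite ?mul0r ?mul1r ?tlip_ge0//=; lra.
Qed.

(** On [[0, e]] the coarse profile is at least its value [k e] at [e], while the fine one is at most
    [k e] at [e] and grows towards 0 by at most [tlip e' * e]. *)
Lemma tkernel_diff e e' x : 0 < e' -> e' <= e ->
  0 <= tkernel e' x - tkernel e x <= tlip e' * e * (`|x| <= e)%R%:R.
Proof.
move=> e0 ee; apply/andP; split; first by rewrite subr_ge0 tprofile_le.
have [xe|ex] := leP `|x| e; last first.
  by rewrite mulr0 /tkernel !tprofile_big ?subrr// (le_lt_trans ee).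
rewrite mulr1.
have e1 := lt_le_trans e0 ee.
have h1 := tprofile_nincr e1 xe.
have h2 := tprofile_lip `|x| e e0.
have h3 : tprofile e' e <= tprofile e e.
  rewrite [leRHS]/tprofile lexx subrr mulr0 addr0; exact: tprofile_le_profile.
have h4 : tlip e' * `| `|x| - e| <= tlip e' * e.
  rewrite ler_wpM2l ?tlip_ge0// ler0_norm ?subr_le0// opprB.
  by rewrite gerBl.
move: h2; rewrite ler_norml => /andP[_].
rewrite /tkernel; lra.
Qed.

Lemma tkernel'_diff e e' x : 0 < e' -> e' <= e ->
  `|tkernel' e' x - tkernel' e x| <= tlip e' * (`|x| <= e)%R%:R.
Proof.
move=> e0 ee; have e1 := lt_le_trans e0 ee.
rewrite /tkernel' -mulrBr normrM.
have [xe|ex] := leP `|x| e; last first.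
  by rewrite !tslope_big ?subrr ?normr0 ?mulr0 ?(le_trans ee)// ltW.
rewrite mulr1 (@le_trans _ _ `|tslope e' `|x| - tslope e `|x| |)//.
  rewrite normr_sg; case: (x == 0); rewrite ?mul1r//= mul0r//.
have := tslope_ge `|x| e0; have := tslope_le0 e' `|x|.
rewrite (tslope_small xe).
have := tlip_le e0 ee; have := tlip_ge0 e.
by rewrite ler_norml; lra.
Qed.

(* This fails at x = 0, where the kernel has a concave kink. *)
Lemma tkernel_tangent e x y : 0 < e -> x != 0 -> 0 <= x * y ->
  tkernel e x + tkernel' e x * (y - x) <= tkernel e y.
Proof.
move=> e0; rewrite neq_lt => /orP[] x0 xy.
- have y0 : y <= 0 by rewrite nmulr_rge0 in xy.
  have := tprofile_tangent `|x| `|y| e0.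
  rewrite /tkernel /tkernel' ltr0_sg//.
  rewrite (ltr0_norm x0) (ler0_norm y0); lra.
- have y0 : 0 <= y by rewrite pmulr_rge0 in xy.
  have := tprofile_tangent `|x| `|y| e0.
  rewrite /tkernel /tkernel' gtr0_sg//.
  rewrite (gtr0_norm x0) (ger0_norm y0); lra.
Qed.

Lemma continuous_tslope e : 0 < e -> continuous (tslope e).
Proof.
move=> e0 x; apply: cvgMr => //.
have h : {for Num.max x e, continuous (fun r => r `^ b)}.
  apply: differentiable_continuous; apply/derivable1_diffP.
  by apply: derivable_powR; rewrite in_itv/= andbT lt_max e0 orbT.
apply: (@continuous_comp _ _ _ (fun r => Num.max r e) (fun r => r `^ b)) => //.
apply: (@continuous_max _ R^o id (cst e)) => //; exact: cvg_cst.
Qed.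

Lemma measurable_tslope e : 0 < e -> measurable_fun setT (tslope e).
Proof.
by move=> e0; apply: continuous_measurable_fun; exact: continuous_tslope.
Qed.

Lemma measurable_tkernel' e : 0 < e -> measurable_fun setT (tkernel' e).
Proof.
move=> e0; apply: measurable_funM.
  apply: nondecreasing_measurable => // x y xy.
  by case: (sgrP x) xy => x0; case: (sgrP y) => y0; lra.
by apply: measurableT_comp (measurable_tslope e0) _; exact: normr_measurable.
Qed.

Lemma continuous_tkernel e : 0 < e -> continuous (tkernel e).
Proof.
move=> e0 x; apply/cvgrPdist_le => /= d d0.
have L0 := tlip_ge0 e.
near=> y; apply: le_trans (tkernel_lip _ _ e0) _.
apply: (@le_trans _ _ ((tlip e + 1) * `|x - y|)).
  by rewrite ler_wpM2r// lerDl.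
rewrite mulrC -ler_pdivlMr; last by rewrite ltr_wpDl.
near: y; apply: (@cvgr_dist_le _ _ _ _ _ id x) => //.
by rewrite divr_gt0// ltr_wpDl.
Unshelve. all: by end_near. Qed.

Lemma measurable_tkernel e : 0 < e -> measurable_fun setT (tkernel e).
Proof.
by move=> e0; apply: continuous_measurable_fun; exact: continuous_tkernel.
Qed.

(** The tangent inequalities based at [x] and at [x + h n] trap the quotient between [tkernel' e x]
    and [tkernel' e (x + h n)]. They apply because [x + h n] is eventually on the same side of 0 as
    [x]. *)
Lemma tkernel_quotient_cvg e x (h : R ^nat) : 0 < e -> x != 0 ->
  (forall n, h n != 0) -> h n @[n --> \oo] --> 0 ->
  (h n)^-1 * (tkernel e (x + h n) - tkernel e x) @[n --> \oo] --> tkernel' e x.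
Proof.
move=> e0 x0 h0 hn.
have cx : x + h n @[n --> \oo] --> x.
  by rewrite -[X in _ --> X]addr0; apply: cvgD => //; exact: cvg_cst.
have sgx : \forall n \near \oo, 0 < x * (x + h n).
  have : x * (x + h n) @[n --> \oo] --> x * x by apply: cvgMr.
  move=> /cvgr_gt; apply; by rewrite -expr2 exprn_even_gt0.
have c1 : tkernel' e (x + h n) @[n --> \oo] --> tkernel' e x.
  have : Num.sg x * tslope e `|x + h n| @[n --> \oo] --> tkernel' e x.
    apply: cvgMr; apply: continuous_cvg; first exact: continuous_tslope.
    exact: cvg_norm.
  apply: cvg_trans; apply: near_eq_cvg.
  near=> n; rewrite /tkernel'; congr (_ * _).
  have : 0 < x * (x + h n) by near: n.
  move: x0; rewrite neq_lt => /orP[] x0.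
    by rewrite nmulr_rgt0// => y0; rewrite !ltr0_sg.
  by rewrite pmulr_rgt0// => y0; rewrite !gtr0_sg.
have c2 : `|tkernel' e (x + h n) - tkernel' e x| @[n --> \oo] --> 0.
  rewrite -(@normr0 _ R^o) -(subrr (tkernel' e x)); apply: cvg_norm.
  by apply: cvgB => //; exact: cvg_cst.
apply: cvg_zero; apply: norm_cvg0.
apply: (squeeze_cvgr _ (cvg_cst 0) c2).
near=> n; rewrite normr_ge0/= !fctE.
have xy : 0 < x * (x + h n) by near: n.
have y0 : x + h n != 0 by apply: contraTneq xy => ->; rewrite mulr0 ltxx.
have h1 := tkernel_tangent e0 x0 (ltW xy).
have h2 : tkernel e (x + h n) + tkernel' e (x + h n) * (x - (x + h n)) <= tkernel e x.
  by apply: tkernel_tangent => //; rewrite mulrC ltW.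
have E : (h n)^-1 * (tkernel e (x + h n) - tkernel e x) - tkernel' e x =
  (tkernel e (x + h n) - tkernel e x - tkernel' e x * h n) / h n.
  by field; exact: h0.
rewrite [X in `|X|]E normrM normfV ler_pdivrMr ?normr_gt0//.
rewrite -normrM ger0_norm; last lra.
apply: le_trans (ler_norm _); lra.
Unshelve. all: by end_near. Qed.

End truncated_profile.

(** * Laws, densities and square integrability *)

Section transfer.
Local Open Scope ereal_scope.
Context d1 d2 (T1 : measurableType d1) (T2 : measurableType d2) (R : realType).
Variables (P : {measure set T1 -> \bar R}) (Q : {measure set T2 -> \bar R}).
Variable X : T1 -> T2.
Hypothesis mX : measurable_fun [set: T1] X.
Hypothesis lawX : forall A, measurable A -> P (X @^-1` A) = Q A.

Lemma ge0_integral_law (f : T2 -> \bar R) : measurable_fun [set: T2] f ->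
  (forall x, 0 <= f x) -> \int[Q]_x f x = \int[P]_x f (X x).
Proof.
move=> mf f0; rewrite -[RHS](@ge0_integral_pushforward _ _ _ _ _ X mX P setT)//.
by apply: eq_measure_integral => A mA _; rewrite -lawX.
Qed.

Lemma integral_law (f : T2 -> \bar R) : measurable_fun [set: T2] f ->
  \int[Q]_x f x = \int[P]_x f (X x).
Proof.
move=> mf; rewrite integralE [RHS]integralE.
under [in RHS]eq_integral do rewrite funepos_comp/=.
under [X in _ = _ - X]eq_integral do rewrite funeneg_comp.
rewrite !ge0_integral_law//; [exact: measurable_funeneg|].
exact: measurable_funepos.
Qed.

Lemma integrable_law (f : T2 -> \bar R) : measurable_fun [set: T2] f ->
  Q.-integrable [set: T2] f <-> P.-integrable [set: T1] (f \o X).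
Proof.
move=> mf; split=> /integrableP[_ fi]; apply/integrableP; split => //.
- exact: measurableT_comp.
- by move: fi; rewrite ge0_integral_law//; exact: measurableT_comp.
- by rewrite ge0_integral_law//; exact: measurableT_comp.
Qed.

End transfer.

Section product_transfer.
Local Open Scope ereal_scope.
Context d1 d2 (T1 : measurableType d1) (T2 : measurableType d2) (R : realType).
Variables (P : probability T1 R) (Q : probability T2 R).
Variable X : T1 -> T2.
Hypothesis mX : measurable_fun [set: T1] X.
Hypothesis lawX : forall A, measurable A -> P (X @^-1` A) = Q A.

Definition square_map (u : T1 * T1) := (X u.1, X u.2).

Lemma measurable_square_map : measurable_fun [set: T1 * T1] square_map.
Proof.
by apply: measurable_fun_pair; apply: measurableT_comp.
Qed.

Lemma product_law A : measurable A ->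
  (P \x P) (square_map @^-1` A) = (Q \x Q) A.
Proof.
move=> mA; apply/esym.
rewrite -[RHS]/(pushforward (P \x P) square_map A).
apply: product_measure_unique => //; first exact: measurable_square_map.
move=> msq B C mB mC; rewrite /= /pushforward.
rewrite -(lawX mB) -(lawX mC) -product_measure1E//.
- by rewrite -[X @^-1` B]setTI; exact: mX.
- by rewrite -[X @^-1` C]setTI; exact: mX.
Qed.

End product_transfer.

Section integral_order.
Local Open Scope ereal_scope.
Context d (T : measurableType d) (R : realType) (m : {measure set T -> \bar R}).

(** The upper function may have an infinite integral: this compares a truncated kernel with [W]. *)
Lemma integrable_le_integral (h f : T -> \bar R) :
  m.-integrable [set: T] h -> measurable_fun [set: T] f ->
  (forall x, h x <= f x) -> \int[m]_x h x <= \int[m]_x f x.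
Proof.
move=> ih mf hf; have mh := measurable_int _ ih.
rewrite integralE [leRHS]integralE; apply: leeB.
- apply: ge0_le_integral => //; do ?exact: measurable_funepos.
  by move=> x _; apply: (@funepos_le _ _ setT) => [y _|]; [exact: hf|rewrite inE].
- apply: ge0_le_integral => //; do ?exact: measurable_funeneg.
  by move=> x _; apply: (@funeneg_le _ _ setT) => [y _|]; [exact: hf|rewrite inE].
Qed.

End integral_order.

Section density_integral.
Context {R : realType} (rho : R -> R).
Local Notation leb := (@lebesgue_measure R).
Context (rho_L1 : leb.-integrable [set: R] (EFin \o rho))
        (rho_ge0 : forall x, 0 <= rho x)
        (rho_mass : (\int[leb]_x (rho x)%:E = 1)%E).
Local Notation P := (density_prob rho_L1 rho_ge0 rho_mass).
Local Open Scope ereal_scope.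

Let mrho : measurable_fun setT rho.
Proof. by have /measurable_int/measurable_EFinP := rho_L1. Qed.

Let indic_density E : measurable E ->
  \int[P]_x (\1_E x)%:E = \int[leb]_x ((\1_E x)%:E * (rho x)%:E).
Proof.
move=> mE; rewrite integral_indic//= setIT /density_prob.
rewrite integral_mkcond; apply: eq_integral => x _.
by rewrite patchE indicE; case: ifPn => _; rewrite ?mul1e ?mul0e.
Qed.

Import HBNNSimple.

Let nnsfun_density (f : {nnsfun (measurableTypeR R) >-> R}) :
  \int[P]_x (f x)%:E = \int[leb]_x ((f x)%:E * (rho x)%:E).
Proof.
under [LHS]eq_integral do rewrite fimfunE -fsumEFin//.
rewrite [LHS]ge0_integral_fsum//; last 2 first.
  - by move=> r; exact/measurable_EFinP/measurableT_comp.
  - by move=> n x _; rewrite EFinM nnfun_muleindic_ge0.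
under [RHS]eq_integral.
  move=> x xD; rewrite fimfunE -fsumEFin// muleC ge0_mule_fsumr; last first.
    by move=> r; rewrite EFinM nnfun_muleindic_ge0.
  over.
rewrite [RHS]ge0_integral_fsum//; last 2 first.
  - move=> r; apply/measurable_EFinP; apply: measurable_funM => //.
    exact: measurableT_comp.
  - move=> n x _; apply: mule_ge0; first by rewrite lee_fin.
    by rewrite EFinM nnfun_muleindic_ge0.
apply: eq_fsbigr => r _.
rewrite integralZl_indic_nnsfun//= indic_density//.
have [r0|r0] := leP 0%R r.
  rewrite -ge0_integralZl//; last first.
  - by move=> x _; rewrite mule_ge0 ?lee_fin.
  - by apply/measurable_EFinP; exact: measurable_funM.
  by apply: eq_integral => x _; rewrite EFinM [RHS]muleC muleA.
rewrite preimage_nnfun0// (eq_integral (cst 0)); last first.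
  by move=> x _; rewrite indic0 mul0e.
rewrite integral0 mule0 (eq_integral (cst 0)) ?integral0// => x _.
by rewrite indic0 mulr0 mule0.
Qed.

Lemma ge0_integral_density (f : R -> \bar R) :
  measurable_fun [set: measurableTypeR R] f -> (forall x, 0 <= f x) ->
  \int[P]_x f x = \int[leb]_x (f x * (rho x)%:E).
Proof.
move=> mf f0; pose f_ := nnsfun_approx measurableT mf.
transitivity (limn (fun n => \int[P]_x (f_ n x)%:E)).
  rewrite -monotone_convergence//=.
  - apply: eq_integral => x _; apply/esym/cvg_lim => //.
    exact: cvg_nnsfun_approx.
  - by move=> n; exact/measurable_EFinP/measurable_funTS.
  - by move=> n x _; rewrite lee_fin.
  - by move=> x _ m n mn; rewrite lee_fin; exact/lefP/nd_nnsfun_approx.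
under eq_fun do rewrite nnsfun_density.
rewrite -monotone_convergence//=.
- apply: eq_integral => x _; apply/cvg_lim => //.
  under eq_fun do rewrite muleC.
  by rewrite muleC; apply: cvgeZl => //; exact: cvg_nnsfun_approx.
- by move=> n; apply/measurable_EFinP; exact: measurable_funM.
- by move=> n x _; rewrite mule_ge0 ?lee_fin.
- move=> x _ m n mn; rewrite lee_wpmul2r ?lee_fin//.
  exact/lefP/nd_nnsfun_approx.
Qed.

Lemma integral_density (f : R -> \bar R) :
  measurable_fun [set: measurableTypeR R] f ->
  \int[P]_x f x = \int[leb]_x (f x * (rho x)%:E).
Proof.
move=> mf; rewrite integralE [RHS]integralE.
rewrite !ge0_integral_density//; [|exact: measurable_funeneg
                                   |exact: measurable_funepos].
congr (_ - _); apply: eq_integral => x _.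
  by rewrite !funeposE ![_ * (rho x)%:E]muleC maxe_pMr ?lee_fin// mule0.
by rewrite !funenegE ![_ * (rho x)%:E]muleC -muleN maxe_pMr ?lee_fin// mule0.
Qed.

End density_integral.

Section square_integrable.
Context d (T : measurableType d) (R : realType) (P : probability T R).
Variable X : T -> R.
Hypothesis mX : measurable_fun setT X.
Hypothesis X2 : (\int[P]_u (X u ^+ 2)%:E < +oo)%E.

Lemma sqr_integrable : P.-integrable setT (fun u => (X u ^+ 2)%:E).
Proof.
apply/integrableP; split.
  by apply/measurable_EFinP; exact: measurable_funX.
by under eq_integral do rewrite gee0_abs ?lee_fin ?sqr_ge0//.
Qed.

Lemma sqr_integrable1 : P.-integrable setT (fun u => (X u)%:E).
Proof.
have i1 : P.-integrable setT (fun u => (1 + X u ^+ 2)%:E).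
  under eq_fun do rewrite EFinD.
  apply: integrableD => //; first exact: finite_measure_integrable_cst.
  exact: sqr_integrable.
apply: le_integrable i1 => //; first exact/measurable_EFinP.
move=> u _ /=; rewrite lee_fin [leRHS]ger0_norm ?addr_ge0 ?sqr_ge0//.
by rewrite ler_norml; have := sqr_ge0 (X u - 1); have := sqr_ge0 (X u + 1); nra.
Qed.

End square_integrable.

Lemma sqr_lty d (T : measurableType d) (R : realType)
    (m : {measure set T -> \bar R}) (h F : T -> R) :
  measurable_fun setT h -> m.-integrable setT (EFin \o F) ->
  (forall u, h u ^+ 2 <= F u) -> (\int[m]_u (h u ^+ 2)%:E < +oo)%E.
Proof.
move=> mh iF hF; apply: le_lt_trans (integrable_lty measurableT iF) => //.
apply: ge0_le_integral => //.
- by move=> u _; rewrite lee_fin sqr_ge0.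
- by apply/measurable_EFinP; exact: measurable_funX.
- exact: measurable_int iF.
- by move=> u _; rewrite lee_fin.
Qed.

Section product_marginals.
Context d (T : measurableType d) (R : realType) (P : probability T R).
Local Open Scope ereal_scope.

Lemma product_fst (A : set T) : measurable A -> (P \x P) (fst @^-1` A) = P A.
Proof.
move=> mA; have -> : fst @^-1` A = A `*` [set: T].
  by apply/seteqP; split=> -[u v] //= [].
by rewrite product_measure1E//= probability_setT mule1.
Qed.

Lemma product_snd (A : set T) : measurable A -> (P \x P) (snd @^-1` A) = P A.
Proof.
move=> mA; have -> : snd @^-1` A = [set: T] `*` A.
  by apply/seteqP; split=> -[u v] //= [].
by rewrite product_measure1E//= probability_setT mul1e.
Qed.

Lemma integrable_fst (f : T -> \bar R) : P.-integrable setT f ->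
  (P \x P).-integrable setT (f \o fst).
Proof.
move=> fi; apply/(integrable_law _ product_fst) => //.
exact: measurable_int fi.
Qed.

Lemma integrable_snd (f : T -> \bar R) : P.-integrable setT f ->
  (P \x P).-integrable setT (f \o snd).
Proof.
move=> fi; apply/(integrable_law _ product_snd) => //.
exact: measurable_int fi.
Qed.

End product_marginals.

Section nonneg_ae.
Context d (T : measurableType d) (R : realType) (m : {measure set T -> \bar R}).

(** Serves to integrate the tangent inequality, which is available only off the diagonal
    [X u = X v]. *)
Lemma ae_ge0_Rintegral (f : T -> R) (N : set T) :
  m.-integrable setT (EFin \o f) -> measurable N -> m N = 0%E ->
  (forall x, ~ N x -> 0 <= f x) -> 0 <= \int[m]_x f x.
Proof.
move=> fi mN N0 f0; have mf := measurable_int _ fi.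
rewrite /Rintegral (ae_eq_integral (fun x => `|f x|%:E))//.
- by apply: fine_ge0; apply: integral_ge0 => x _; rewrite lee_fin.
- by apply/measurable_EFinP/measurableT_comp => //; exact/measurable_EFinP.
- exists N; split => // x /= nfx; apply: contrapT => Nx; apply: nfx => _.
  by rewrite ger0_norm// f0.
Qed.

End nonneg_ae.

(** * Monotone coupling by quantile functions *)

Section quantile.
Context {R : realType} (Q : probability (measurableTypeR R) R).
Implicit Types x u : R.

Definition distribution_function x := fine (Q `]-oo, x]%classic).

Local Notation F := distribution_function.

(** The identity viewed as a random variable of law [Q], so that the results on [cdf] apply to
    [Q]. *)
Let idR : measurableTypeR R -> R := idfun.

#[local] HB.instance Definition _ :=
  @isMeasurableFun.Build _ _ _ _ idR (@measurable_id _ _ setT).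

Let cdfE x : cdf (idR : {RV Q >-> R}) x = (F x)%:E.
Proof. by rewrite /F fineK ?fin_num_measure. Qed.

Lemma distribution_functionE x : (Q `]-oo, x]%classic = (F x)%:E)%E.
Proof. by rewrite /F fineK ?fin_num_measure. Qed.

Lemma distribution_function_ge0 x : 0 <= F x.
Proof. by rewrite -lee_fin -cdfE cdf_ge0. Qed.

Lemma distribution_function_le1 x : F x <= 1.
Proof. by rewrite -lee_fin -cdfE cdf_le1. Qed.

Lemma distribution_function_ndecr x y : x <= y -> F x <= F y.
Proof. by move=> xy; rewrite -lee_fin -!cdfE cdf_nondecreasing. Qed.

Lemma distribution_function_exists_lt u : 0 < u -> exists x, F x < u.
Proof.
move=> u0; have /fine_cvgP[_ /cvgr_lt] := cvg_cdfNy0 (idR : {RV Q >-> R}).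
move=> /(_ u u0) [x [_ xu]]; exists (x - 1).
by apply: xu; rewrite ltrBlDr ltrDl.
Qed.

Lemma distribution_function_exists_gt u : u < 1 -> exists x, u < F x.
Proof.
move=> u1; have /fine_cvgP[_ /cvgr_gt] := cvg_cdfy1 (idR : {RV Q >-> R}).
move=> /(_ u u1) [x [_ xu]]; exists (x + 1).
by apply: xu; rewrite ltrDl.
Qed.

Lemma distribution_function_right_closed x u :
  (forall y, x < y -> u <= F y) -> u <= F x.
Proof.
move=> h; rewrite leNgt; apply/negP => Fxu.
have c : (F y) @[y --> x^'+] --> F x.
  apply: fine_cvg; rewrite -distribution_functionE.
  exact: (@cdf_right_continuous _ _ _ _ (idR : {RV Q >-> R})).
have [y xy yu] : exists2 y, x < y & F y < u.
  have : \forall y \near x^'+, F y < u by exact: cvgr_lt c _ Fxu.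
  move=> H; near x^'+ => y; exists y => //; near: y => //.
by move: (h _ xy); rewrite leNgt yu.
Unshelve. all: by end_near. Qed.

Definition quantile u := inf [set x | u <= F x].

(** Right-continuity makes the infimum attained, hence this Galois connection; [0 < u < 1] makes the
    set nonempty and bounded below. *)
Lemma quantile_le u x : 0 < u < 1 -> (quantile u <= x) = (u <= F x).
Proof.
move=> /andP[u0 u1].
have [z zu] := distribution_function_exists_lt u0.
have [w wu] := distribution_function_exists_gt u1.
have hi : has_inf [set x | u <= F x].
  split; first by exists w; exact: ltW.
  exists z => y /= uy; rewrite leNgt; apply/negP => yz.
  by have := lt_le_trans zu uy; rewrite ltNge distribution_function_ndecr// ltW.
apply/idP/idP => [qx|ux].
  apply: distribution_function_right_closed => y xy.
  have [v /= uv vy] := inf_lt hi.1 (le_lt_trans qx xy).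
  exact: le_trans uv (distribution_function_ndecr (ltW vy)).
by apply: ge_inf => //; have [] := hi.
Qed.

End quantile.

Section uniform01.
Context {R : realType}.
Implicit Types u c : R.

Definition uniform01 : probability (measurableTypeR R) R :=
  uniform_prob (@ltr01 R).

(* The value off ]0, 1[ is irrelevant up to null sets, but any constant inside
   makes quantile functions composed with clamp01 comonotone everywhere. *)
Definition clamp01 u := if 0 < u < 1 then u else 2^-1 : R.

Lemma clamp01P u : 0 < clamp01 u < 1.
Proof. by rewrite /clamp01; case: ifPn => // _; lra. Qed.

Lemma measurable_clamp01 : measurable_fun [set: R] clamp01.
Proof.
apply: measurable_fun_if => //.
apply: measurable_and; exact: measurable_fun_ltr.
Qed.

Lemma uniform01_itv (A : set (measurableTypeR R)) : measurable A ->
  uniform01 A = lebesgue_measure (A `&` `]0, 1[%classic).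
Proof.
move=> mA; rewrite /uniform01/= /uniform_prob integral_uniform_pdf.
rewrite (eq_integral (cst 1%E)); last first.
  move=> x; rewrite inE => -[_ /=]; rewrite in_itv/= => x01.
  by rewrite /uniform_pdf x01 subr0 invr1.
rewrite integral_cst ?mul1e; last exact: measurableI.
(* The uniform density lives on the closed interval, whose endpoints are null. *)
have -> : `[0, 1]%classic = [set (0:R)] `|` `]0, 1[%classic `|` [set 1].
  by rewrite setU1itv ?bnd_simp// setUitv1 ?bnd_simp.
rewrite !setIUr.
have null (x : R) : lebesgue_measure (A `&` [set x]) = 0%E.
  apply/eqP; rewrite eq_le measure_ge0 andbT -(lebesgue_measure_set1 x).
  by apply: le_measure; rewrite ?inE//; exact: measurableI.
rewrite measureU0//; [|by apply: measurableU; exact: measurableI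
                      |exact: measurableI|exact: null].
by rewrite setUC measureU0//; [exact: measurableI..|exact: null].
Qed.

Lemma uniform01_clamp01_gt c : 0 <= c <= 1 ->
  uniform01 (clamp01 @^-1` `]c, +oo[%classic) = (1 - c)%:E.
Proof.
move=> /andP[c0 c1]; rewrite uniform01_itv; last first.
  by rewrite -[X in measurable X]setTI; exact: measurable_clamp01.
have -> : clamp01 @^-1` `]c, +oo[ `&` `]0, 1[ = `]c, 1[%classic.
  apply/seteqP; split=> u /=; rewrite !in_itv/= /clamp01.
    by move=> [+ u01]; rewrite u01 andbT => ->; case/andP: u01.
  by move=> /andP[cu u1]; rewrite andbT u1 (le_lt_trans c0 cu).
rewrite lebesgue_measure_itv/= lte_fin; case: ltP => //.
by case: ltgtP c1 => // ->; rewrite subrr.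
Qed.

End uniform01.

Section quantile_law.
Context {R : realType} (Q : probability (measurableTypeR R) R).

Definition quantile_rv (u : measurableTypeR R) : measurableTypeR R :=
  quantile Q (clamp01 u).

Lemma quantile_rv_gt x u :
  (x < quantile_rv u) = (distribution_function Q x < clamp01 u).
Proof. by rewrite !ltNge quantile_le// clamp01P. Qed.

Lemma quantile_rv_gt_preimage x : quantile_rv @^-1` `]x, +oo[ =
  clamp01 @^-1` `](distribution_function Q x), +oo[.
Proof.
by apply/seteqP; split=> u /=; rewrite !in_itv/= !andbT quantile_rv_gt.
Qed.

Lemma measurable_quantile_rv : measurable_fun setT quantile_rv.
Proof.
apply: (measurability _ (RGenOInfty.measurableE R)) => //.
move=> _ [_ [x ->] <-]; rewrite setTI quantile_rv_gt_preimage.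
by rewrite -[X in measurable X]setTI; exact: measurable_clamp01.
Qed.

(** The rays []x, +oo[] are stable under intersection and generate the Borel sets; by the Galois
    connection each of them pulls back to a ray for [clamp01], whose mass is known. *)
Lemma quantile_law (A : set (measurableTypeR R)) : measurable A ->
  uniform01 (quantile_rv @^-1` A) = Q A.
Proof.
move=> mA; rewrite -[LHS]/(pushforward uniform01 quantile_rv A).
apply: (@measure_unique _ R (measurableTypeR R) (@RGenOInfty.G R)
  (fun k => `](- k%:R), +oo[%classic)).
- exact: RGenOInfty.measurableE.
- move=> _ _ [x ->] [y ->]; exists (Num.max x y).
  apply/seteqP; split=> z /=; rewrite !in_itv/= !andbT gt_max.
    by move=> [-> ->].
  by move=> /andP[].
- by move=> k; eexists.
- apply/seteqP; split=> // x _; exists (Num.truncn `|x|).+1 => //=.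
  rewrite in_itv/= andbT ltrNl; apply: le_lt_trans (truncnS_gt _).
  by rewrite -normrN ler_norm.
- exact: measurable_quantile_rv.
- move=> mq _ [x ->]; rewrite /= /pushforward quantile_rv_gt_preimage.
  rewrite uniform01_clamp01_gt; last first.
    by rewrite distribution_function_ge0 distribution_function_le1.
  rewrite -[in RHS]setCitvl probability_setC// distribution_functionE.
  by rewrite EFinB.
- move=> mq k; apply: le_lt_trans (ltry 1).
  by apply: probability_le1; rewrite -[X in measurable X]setTI; exact: mq.
- exact: mA.
Qed.

End quantile_law.

Lemma quantile_rv_comonotone {R : realType}
    (Q Q' : probability (measurableTypeR R) R) (u v : R) :
  0 <= (quantile_rv Q u - quantile_rv Q v) * (quantile_rv Q' u - quantile_rv Q' v).
Proof.
have mono (Q1 : probability (measurableTypeR R) R) (a b : R) :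
    clamp01 a <= clamp01 b -> quantile_rv Q1 a <= quantile_rv Q1 b.
  move=> ab; rewrite leNgt quantile_rv_gt -leNgt.
  by rewrite (le_trans ab)// -quantile_le ?clamp01P.
have [uv|/ltW vu] := leP (clamp01 u) (clamp01 v).
  by rewrite mulr_le0// subr_le0 mono.
by rewrite mulr_ge0// subr_ge0 mono.
Qed.

(** * Optimality of comonotone couplings *)

(* Hoeffding's formula: (y - x)^2 = |[x, y[ x [x, y[| for x <= y turns the
   quadratic cost into an integral of probabilities. *)
Section excess_square.
Context d (T : measurableType d) (R : realType).
Variables (P : probability T R) (f g : T -> R).
Hypotheses (mf : measurable_fun setT f) (mg : measurable_fun setT g).
Local Notation leb := (@lebesgue_measure R).
Local Notation RB := (measurableTypeR R).
Local Open Scope ereal_scope.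

(** Half-open, so that the event in [u] is the sublevel set [f u <= a] minus the sublevel set
    [g u <= a]; their probabilities depend on the marginal laws alone. *)
Definition crosses (x y a : R) := (x <= a < y)%R.

Let measurable_crosses :
  measurable_fun setT (fun z : T * RB => crosses (f z.1) (g z.1) z.2).
Proof.
apply: measurable_and.
- apply: measurable_fun_ler; last exact: measurable_snd.
  exact: measurableT_comp.
- apply: measurable_fun_ltr; first exact: measurable_snd.
  exact: measurableT_comp.
Qed.

Let measurable_indic_bool d1 (T1 : measurableType d1) (h : T1 -> bool) :
  measurable_fun setT h -> measurable_fun setT (fun z => (h z)%:R%:E : \bar R).
Proof.
move=> mh; apply/measurable_EFinP.
rewrite (_ : (fun _ => _) = (fun z => if h z then 1 else 0)%R).
  exact: measurable_fun_if.
by apply/funext => z; case: (h z).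
Qed.

Let measurable_crosses_at a : measurable_fun setT (fun u => crosses (f u) (g u) a).
Proof. exact: (measurableT_comp measurable_crosses (measurable_pair2 a)). Qed.

Lemma integral_crosses (x y : R) :
  \int[leb]_a (crosses x y a)%:R%:E = (Num.max (y - x) 0)%:E.
Proof.
rewrite (eq_integral (fun a : RB => (\1_(`[x, y[) a)%:E)); last first.
  by move=> a _; rewrite indicE mem_setE/= in_itv.
rewrite integral_indic// setIT.
have lebxy : leb `[x, y[%classic = (Num.max (y - x) 0)%:E.
  rewrite lebesgue_measure_itv/= lte_fin maxC /Num.max subr_gt0.
  by case: ifPn.
exact: lebxy.
Qed.

Let integral_crosses2 (x y a : R) :
  \int[leb]_b (crosses x y a && crosses x y b)%:R%:E =
  (crosses x y a)%:R%:E * (Num.max (y - x) 0)%:E.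
Proof.
case: (crosses x y a); first by rewrite mul1e integral_crosses.
by rewrite mul0e integral0.
Qed.

Lemma sqr_excess (x y : R) : ((Num.max (y - x) 0) ^+ 2)%:E =
  \int[leb]_a \int[leb]_b (crosses x y a && crosses x y b)%:R%:E.
Proof.
under eq_integral do rewrite integral_crosses2 muleC.
have max0 : (0 <= Num.max (y - x) 0)%R by rewrite le_max lexx orbT.
rewrite ge0_integralZl//.
- by rewrite integral_crosses -EFinM expr2.
- apply: measurable_indic_bool.
  by apply: measurable_and; [exact: measurable_fun_ler|exact: measurable_fun_ltr].
Qed.

Let measurable_inner : measurable_fun setT (fun z : T * RB =>
  \int[leb]_b (crosses (f z.1) (g z.1) z.2 && crosses (f z.1) (g z.1) b)%:R%:E).
Proof.
under eq_fun do rewrite integral_crosses2 -EFinM.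
apply/measurable_EFinP; apply: measurable_funM.
  exact/measurable_EFinP/measurable_indic_bool.
apply: measurable_maxr => //; apply: measurable_funB; exact: measurableT_comp.
Qed.

Let inner (z : T * RB) : \bar R :=
  \int[leb]_b (crosses (f z.1) (g z.1) z.2 && crosses (f z.1) (g z.1) b)%:R%:E.

Let inner_ge0 z : 0 <= inner z.
Proof. by apply: integral_ge0 => b _; rewrite lee_fin. Qed.

Let slice (a : R) (z : T * RB) : \bar R :=
  (crosses (f z.1) (g z.1) a && crosses (f z.1) (g z.1) z.2)%:R%:E.

Let slice_ge0 a z : 0 <= slice a z. Proof. by rewrite lee_fin. Qed.

Let measurable_slice a : measurable_fun setT (slice a).
Proof.
apply: measurable_indic_bool; apply: measurable_and => //.
exact: (measurableT_comp (measurable_crosses_at a)).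
Qed.

Let integral_slice a b : \int[P]_u slice a (u, b) =
  P [set u | crosses (f u) (g u) a && crosses (f u) (g u) b].
Proof.
have mS : measurable [set u | crosses (f u) (g u) a && crosses (f u) (g u) b].
  have := measurable_and (measurable_crosses_at a) (measurable_crosses_at b).
  by move=> /(_ measurableT [set true]); rewrite setTI; apply.
rewrite -[in RHS](setIT [set u | _]) -integral_indic//.
by apply: eq_integral => u _; rewrite indicE mem_setE.
Qed.

Let integral_inner a : \int[P]_u inner (u, a) = \int[leb]_b
  P [set u | crosses (f u) (g u) a && crosses (f u) (g u) b].
Proof.
apply: etrans (fubini_tonelli (slice a) (measurable_slice a) (slice_ge0 a)) _.
by apply: eq_integral => b _; exact: integral_slice.
Qed.

(** Tonelli twice: [a] and then [b] are moved outside the expectation, through [inner] and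
    [slice]. *)
Lemma integral_sqr_excess :
  \int[P]_u ((Num.max (g u - f u) 0) ^+ 2)%:E = \int[leb]_a \int[leb]_b
    P [set u | crosses (f u) (g u) a && crosses (f u) (g u) b].
Proof.
under eq_integral do rewrite sqr_excess.
apply: etrans (fubini_tonelli inner measurable_inner inner_ge0) _.
by apply: eq_integral => a _; exact: integral_inner.
Qed.

Lemma measurable_crosses_measure1 (a : R) : measurable_fun setT (fun b : RB =>
  P [set u | crosses (f u) (g u) a && crosses (f u) (g u) b]).
Proof.
under eq_fun do rewrite -integral_slice.
exact: (measurable_fun_fubini_tonelli_G (slice a)).
Qed.

Lemma measurable_crosses_measure2 : measurable_fun setT (fun a : RB =>
  \int[leb]_b P [set u | crosses (f u) (g u) a && crosses (f u) (g u) b]).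
Proof.
under eq_fun do rewrite -integral_inner.
exact: (measurable_fun_fubini_tonelli_G inner).
Qed.

End excess_square.

Section comonotone_optimality.
Context d1 d2 (T1 : measurableType d1) (T2 : measurableType d2) (R : realType).
Variables (P : probability T1 R) (Q : probability T2 R).
Local Open Scope ereal_scope.

(* For a comonotone pair the event X <= lo <= hi < Y is either empty or has
   probability P(X <= lo) - P(Y <= hi), the least possible value. *)
Lemma comonotone_crosses (X Y : T1 -> R) (X' Y' : T2 -> R) :
  measurable_fun setT X -> measurable_fun setT Y ->
  measurable_fun setT X' -> measurable_fun setT Y' ->
  (forall a, P (X @^-1` `]-oo, a]) = Q (X' @^-1` `]-oo, a])) ->
  (forall a, P (Y @^-1` `]-oo, a]) = Q (Y' @^-1` `]-oo, a])) ->
  (forall u v, 0 <= (X u - X v) * (Y u - Y v))%R ->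
  forall a b, P [set u | crosses (X u) (Y u) a && crosses (X u) (Y u) b] <=
    Q [set u | crosses (X' u) (Y' u) a && crosses (X' u) (Y' u) b].
Proof.
move=> mX mY mX' mY' lX lY XY a b.
pose lo := Num.min a b; pose hi := Num.max a b.
have lohi : (lo <= hi)%R by rewrite /lo /hi ge_min !le_max !lexx.
have crossesE d (T : measurableType d) (f g : T -> R) :
    [set u | crosses (f u) (g u) a && crosses (f u) (g u) b] =
    f @^-1` `]-oo, lo] `\` g @^-1` `]-oo, hi].
  apply/seteqP; split=> u /=; rewrite /crosses/= !in_itv/= /lo /hi le_min le_max.
    move=> /andP[/andP[-> ay] /andP[-> bY]]; split=> //.
    by rewrite !leNgt ay bY.
  by move=> [/andP[-> ->] /negP]; rewrite negb_or -!ltNge => /andP[-> ->].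
rewrite !crossesE.
have mpre d (T : measurableType d) (f : T -> R) (r : R) : measurable_fun setT f ->
    measurable (f @^-1` `]-oo, r]).
  by move=> mf; rewrite -[X in measurable X]setTI; exact: mf.
have [->|] := eqVneq (X @^-1` `]-oo, lo] `\` Y @^-1` `]-oo, hi]) set0.
  by rewrite measure0.
move=> /set0P[u0 [/=]]; rewrite !in_itv/= => Xu0 /negP; rewrite -ltNge => Yu0.
(* Comonotonicity with [u0]: from [Y u <= hi < Y u0] follows [X u <= X u0 <= lo]. *)
have sub : Y @^-1` `]-oo, hi] `<=` X @^-1` `]-oo, lo].
  move=> u /=; rewrite !in_itv/= => Yu; apply: le_trans Xu0.
  rewrite leNgt; apply/negP => X0u; have := XY u u0.
  rewrite pmulr_rge0 ?subr_gt0// subr_ge0 leNgt => /negP; apply.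
  exact: le_lt_trans Yu Yu0.
have finY : P (Y @^-1` `]-oo, hi]) \is a fin_num by apply: fin_num_measure; exact: mpre.
have PX : P (X @^-1` `]-oo, lo]) =
    P (X @^-1` `]-oo, lo] `\` Y @^-1` `]-oo, hi]) + P (Y @^-1` `]-oo, hi]).
  rewrite -[in X in _ + X](setIidr sub); apply: measureDI; exact: mpre.
(* After adding [P (Y <= hi) = Q (Y' <= hi)] the left side is [Q (X' <= lo)], and the claim is
   subadditivity under [Q]. *)
rewrite -(leeD2rE _ _ finY) -PX lX lY; apply: (@le_trans _ _
  (Q ((X' @^-1` `]-oo, lo] `\` Y' @^-1` `]-oo, hi]) `|` Y' @^-1` `]-oo, hi]))).
  apply: le_measure; rewrite ?inE; [exact: mpre| |].
    by apply: measurableU; [apply: measurableD|]; exact: mpre.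
  by move=> u Xu; have [|] := pselect ((Y' @^-1` `]-oo, hi]) u); [right|left].
by apply: measureU2; [apply: measurableD|]; exact: mpre.
Qed.

(** The cost splits into the squares of the two one-sided excesses. Each is an integral of crossing
    probabilities over [(a, b)], and comonotonicity minimizes these pointwise; exchanging [X] and
    [Y] gives the second excess. *)
Lemma comonotone_optimal (X Y : T1 -> R) (X' Y' : T2 -> R) :
  measurable_fun setT X -> measurable_fun setT Y ->
  measurable_fun setT X' -> measurable_fun setT Y' ->
  (forall a, P (X @^-1` `]-oo, a]) = Q (X' @^-1` `]-oo, a])) ->
  (forall a, P (Y @^-1` `]-oo, a]) = Q (Y' @^-1` `]-oo, a])) ->
  (forall u v, 0 <= (X u - X v) * (Y u - Y v))%R ->
  \int[P]_u ((X u - Y u) ^+ 2)%:E <= \int[Q]_u ((X' u - Y' u) ^+ 2)%:E.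
Proof.
move=> mX mY mX' mY' lX lY XY.
have sqrE (x y : R) : ((x - y) ^+ 2)%:E =
    ((Num.max (y - x) 0) ^+ 2)%:E + ((Num.max (x - y) 0) ^+ 2)%:E :> \bar R.
  rewrite -EFinD; congr (_%:E).
  by have [xy|yx] := leP x y; [rewrite max_l ?subr_ge0// max_r ?subr_le0//|
    rewrite max_r ?subr_le0 ?ltW// max_l ?subr_ge0 ?ltW//]; ring.
have mexc d (T : measurableType d) (f g : T -> R) : measurable_fun setT f ->
    measurable_fun setT g ->
    measurable_fun setT (fun u => ((Num.max (g u - f u) 0) ^+ 2)%:E : \bar R).
  move=> mf mg; apply/measurable_EFinP; apply: measurable_funX.
  by apply: measurable_maxr => //; exact: measurable_funB.
have splitE d (T : measurableType d) (m : probability T R) (f g : T -> R) :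
    measurable_fun setT f -> measurable_fun setT g ->
    \int[m]_u ((f u - g u) ^+ 2)%:E =
    \int[m]_u ((Num.max (g u - f u) 0) ^+ 2)%:E +
    \int[m]_u ((Num.max (f u - g u) 0) ^+ 2)%:E.
  move=> mf mg; under eq_integral do rewrite sqrE.
  rewrite ge0_integralD//; try exact: mexc.
  - by move=> u _; rewrite lee_fin sqr_ge0.
  - by move=> u _; rewrite lee_fin sqr_ge0.
rewrite !splitE//; apply: leeD; rewrite !integral_sqr_excess//.
- apply: ge0_le_integral => //; try exact: measurable_crosses_measure2.
    by move=> a _; apply: integral_ge0.
  move=> a _; apply: ge0_le_integral => //;
    try exact: measurable_crosses_measure1.
  by move=> b _; exact: comonotone_crosses.
- apply: ge0_le_integral => //; try exact: measurable_crosses_measure2.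
    by move=> a _; apply: integral_ge0.
  move=> a _; apply: ge0_le_integral => //;
    try exact: measurable_crosses_measure1.
  by move=> b _; apply: comonotone_crosses => // u v; rewrite mulrC.
Qed.

End comonotone_optimality.

(** * Potentials and interaction energies *)

Section geometric_increments.
Context {R : realType}.
Variables (a : R ^nat) (A q : R).
Hypotheses (A0 : 0 <= A) (q0 : 0 <= q) (q1 : q < 1).
Hypothesis aq : forall n, `|a n.+1 - a n| <= A * q ^+ n.

Lemma geometric_increments_dist n m : (n <= m)%N ->
  `|a m - a n| <= A / (1 - q) * q ^+ n.
Proof.
have q1' : 0 < 1 - q by rewrite subr_gt0.
(* The factor [1 - q ^+ j], exact for a finite geometric sum, is what lets the induction on [j]
   close. *)
suff h j : `|a (n + j)%N - a n| <= A / (1 - q) * q ^+ n * (1 - q ^+ j).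
  move=> nm; rewrite -(subnKC nm); apply: le_trans (h _) _.
  rewrite ler_piMr//.
    by rewrite !mulr_ge0// ?invr_ge0 ?exprn_ge0// ltW.
  by rewrite gerBl exprn_ge0.
elim: j => [|j IH]; first by rewrite addn0 !subrr normr0 mulr0.
rewrite addnS.
have -> : a (n + j).+1 - a n = (a (n + j).+1 - a (n + j)%N) + (a (n + j)%N - a n).
  by ring.
apply: le_trans (ler_normD _ _) _.
apply: le_trans (lerD (aq _) IH) _.
rewrite le_eqVlt; apply/orP; left; apply/eqP.
rewrite exprD exprS; field; lra.
Qed.

Lemma geometric_increments_cvg : cvgn a.
Proof.
have q1' : 0 < 1 - q by rewrite subr_gt0.
apply/cauchy_cvgP; apply: cauchy_exP => e e0.
have c0 : A / (1 - q) * q ^+ n @[n --> \oo] --> 0.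
  by apply: cvg_geometric; rewrite ger0_norm.
near \oo => n; exists (a n).
exists n => // m /= nm; rewrite /ball/= distrC.
apply: le_lt_trans (geometric_increments_dist nm) _.
by near: n; exact: cvgr_lt c0 _ e0.
Unshelve. all: by end_near. Qed.

Lemma geometric_increments_lim n :
  `|limn a - a n| <= A / (1 - q) * q ^+ n.
Proof.
have c : `|a m - a n| @[m --> \oo] --> `|limn a - a n|.
  by apply: cvg_norm; apply: cvgB; [exact: geometric_increments_cvg|exact: cvg_cst].
apply: (ler_cvg_to c (cvg_cst _)); near=> m; apply: geometric_increments_dist.
by near: m; exact: nbhs_infty_ge.
Unshelve. all: by end_near. Qed.

End geometric_increments.

Lemma is_derive1_cvgP {R : realType} (f : R -> R) (x l : R) :
  (h^-1 * (f (x + h) - f x) @[h --> 0^'] --> l) <-> is_derive x 1 f l.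
Proof.
have E : (fun h => h^-1 *: ((f \o shift x) (h *: 1) - f x)) =
    (fun h => h^-1 * (f (x + h) - f x)).
  by apply/funext => h /=; rewrite /shift/= [h *: 1]mulr1 (addrC h).
split=> [c|[d dl]].
  by apply: DeriveDef; [rewrite /derivable E; apply/cvg_ex; exists l|
    rewrite /derive E; exact/cvg_lim].
by rewrite -dl /derive; move: d; rewrite /derivable E.
Qed.

Section limit_of_derivatives.
Context {R : realType}.
Variables (f g : R -> R) (f_ g_ : (R -> R) ^nat) (del : R ^nat).
Hypothesis f_g : forall n (x : R), is_derive x 1 (f_ n) (g_ n x).
Hypothesis f_f : forall x : R, f_ n x @[n --> \oo] --> f x.
Hypothesis g_le : forall n x, `|g x - g_ n x| <= del n.
Hypothesis del0 : del n @[n --> \oo] --> 0.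

Let mvt m n x y : `|(f_ m y - f_ n y) - (f_ m x - f_ n x)| <=
  (del m + del n) * `|y - x|.
Proof.
wlog xy : x y / x <= y.
  move=> h; have [|/ltW yx] := leP x y; first exact: h.
  by rewrite distrC (distrC y); exact: h.
have d (z : R) : is_derive z 1 (fun y => f_ m y - f_ n y) (g_ m z - g_ n z).
  exact: is_deriveB.
have [|c _ ->] := @MVT_segment R (fun y => f_ m y - f_ n y)
    (fun z => g_ m z - g_ n z) x y xy (fun z _ => d z).
  apply: derivable_within_continuous => z _.
  by have [] := d z.
rewrite normrM ler_wpM2r//.
have -> : g_ m c - g_ n c = (g c - g_ n c) - (g c - g_ m c) by ring.
by rewrite distrC; apply: le_trans (ler_normB _ _) _; exact: lerD.
Qed.

(** Obtained from [mvt] as [m] tends to infinity. The difference quotients of [f - f_ n] are thus at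
    most [del n] whatever the step, which permits the exchange of limits in [is_derive_lim]. *)
Let mvt_lim n x y :
  `|(f y - f_ n y) - (f x - f_ n x)| <= del n * `|y - x|.
Proof.
have c1 : `|(f_ m y - f_ n y) - (f_ m x - f_ n x)| @[m --> \oo] -->
    `|(f y - f_ n y) - (f x - f_ n x)|.
  by apply: cvg_norm; apply: cvgB; apply: cvgB; try exact: cvg_cst; exact: f_f.
have c2 : (del m + del n) * `|y - x| @[m --> \oo] --> (0 + del n) * `|y - x|.
  by apply: cvgMl; apply: cvgD => //; exact: cvg_cst.
rewrite -[del n]add0r; apply: (ler_cvg_to c1 c2).
by apply: nearW => m; exact: mvt.
Qed.

Lemma is_derive_lim (x : R) : is_derive x 1 f (g x).
Proof.
apply/is_derive1_cvgP/cvgrPdist_le => /= e e0.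
have e4 : 0 < e / 4 by rewrite divr_gt0.
near \oo => n.
have dn : del n <= e / 4 by near: n; exact: cvgr_le del0 _ e4.
have /is_derive1_cvgP/cvgrPdist_le/(_ _ e4) dfn := f_g n x.
near=> h.
have h0 : h != 0 by near: h; exact: nbhs_dnbhs_neq.
have q1 : `|g_ n x - h^-1 * (f_ n (x + h) - f_ n x)| <= e / 4 by near: h.
have q2 : `|h^-1 * (f (x + h) - f x) - h^-1 * (f_ n (x + h) - f_ n x)| <= e / 4.
  apply: le_trans dn; rewrite -mulrBr normrM normfV mulrC ler_pdivrMr ?normr_gt0//.
  have := mvt_lim n x (x + h); rewrite (_ : x + h - x = h); last by ring.
  apply: le_trans.
  by rewrite le_eqVlt; apply/orP; left; apply/eqP; congr (`|_|); ring.
have q3 := g_le n x.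
move: q1 q2 q3; rewrite !ler_norml; lra.
Unshelve. all: by end_near. Qed.

End limit_of_derivatives.

(** A derivative is the pointwise limit of the difference quotients with steps [1 / (n + 1)], which
    are measurable because [f] is continuous. *)
Lemma measurable_is_derive {R : realType} (f g : R -> R) :
  (forall x : R, is_derive x 1 f (g x)) -> measurable_fun setT g.
Proof.
move=> fg; have cf : continuous f.
  move=> x; apply: differentiable_continuous; apply/derivable1_diffP.
  by have [] := fg x.
have mf : measurable_fun setT f by exact: continuous_measurable_fun.
pose h n : R := n.+1%:R^-1.
pose q n x := (h n)^-1 * (f (x + h n) - f x).
apply: (@measurable_fun_cvg _ _ _ setT q).
  move=> n; apply: measurable_funM => //; apply: measurable_funB => //.
  by apply: (measurableT_comp mf); exact: measurable_funD.
move=> x _; have /is_derive1_cvgP/cvgr_dnbhsP := fg x; apply; split.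
  by move=> n; rewrite invr_eq0 pnatr_eq0.
exact: cvg_harmonic.
Qed.

(** * Potentials of truncated kernels and their limit *)

Section truncated_potential.
Context {R : realType} (k : R -> R) (kap b : R).
Hypothesis kap_le0 : kap <= 0.
Hypothesis b_le0 : b <= 0.
Hypothesis tangent : forall x y : R, 0 < x -> 0 < y ->
  k x + kap * x `^ b * (y - x) <= k y.
Local Notation RB := (measurableTypeR R).
Variable Q : probability RB R.
Hypothesis Q_abs : Q.-integrable setT (fun y => `|y|%:E).
Variable M : R.
Hypothesis M_ge0 : 0 <= M.
Hypothesis Q_ball : forall x e : R, 0 < e ->
  (Q [set y : R | (`|x - y| <= e)%R] <= (M * e)%:E)%E.
Variables (C alpha : R).
Hypothesis C_ge0 : 0 <= C.
(* Cancellation of odd kernels against a density that is alpha-Hoelder. *)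
Hypothesis Q_odd : forall (D : R -> R) (L e x : R), measurable_fun setT D ->
  0 < e -> 0 <= L -> (forall z, D (- z) = - D z) ->
  (forall z, `|D z| <= L * (`|z| <= e)%R%:R) ->
  `|\int[Q]_y D (x - y)| <= L * (C * e `^ alpha * e).
Implicit Types e x : R.

Local Notation tkernel := (tkernel k kap b).
Local Notation tkernel' := (tkernel' kap b).
Local Notation tlip := (tlip kap b).

Definition tpotential e x := \int[Q]_y tkernel e (x - y).

Definition tpotential' e x := \int[Q]_y tkernel' e (x - y).

Let measurable_shift x : measurable_fun setT (fun y : RB => x - y).
Proof. exact: measurable_funB. Qed.

Let measurable_tkernel_shift e x : 0 < e ->
  measurable_fun setT (fun y : RB => tkernel e (x - y)).
Proof.
by move=> e0; apply: (measurableT_comp (measurable_tkernel kap_le0 b_le0 tangent e0)).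
Qed.

Let measurable_tkernel'_shift e x : 0 < e ->
  measurable_fun setT (fun y : RB => tkernel' e (x - y)).
Proof.
by move=> e0; apply: (measurableT_comp (measurable_tkernel' kap b e0)).
Qed.

Lemma integrable_tkernel e x : 0 < e ->
  Q.-integrable setT (EFin \o (fun y => tkernel e (x - y))).
Proof.
move=> e0.
have ig : Q.-integrable setT
    (fun y => (`|tkernel e x| + tlip e * `|y|)%:E).
  under eq_fun do rewrite EFinD EFinM.
  apply: integrableD => //; first exact: finite_measure_integrable_cst.
  exact: integrableZl.
apply: le_integrable ig => //.
  by apply/measurable_EFinP; exact: measurable_tkernel_shift.
move=> y _ /=; rewrite lee_fin [leRHS]ger0_norm; last first.
  by rewrite addr_ge0// mulr_ge0// tlip_ge0.
have := tkernel_lip kap_le0 b_le0 tangent (x - y) x e0.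
rewrite (_ : x - y - x = - y) ?normrN; last by ring.
move=> h; rewrite (_ : tkernel e (x - y) =
  tkernel e x + (tkernel e (x - y) - tkernel e x)); last by ring.
by apply: le_trans (ler_normD _ _) _; rewrite lerD2l.
Qed.

Lemma integrable_tkernel' e x : 0 < e ->
  Q.-integrable setT (EFin \o (fun y : RB => tkernel' e (x - y))).
Proof.
move=> e0; have ig : Q.-integrable setT (fun y => (tlip e)%:E).
  exact: finite_measure_integrable_cst.
apply: le_integrable ig => //.
  by apply/measurable_EFinP; exact: measurable_tkernel'_shift.
move=> y _ /=; rewrite lee_fin [leRHS]ger0_norm ?tlip_ge0//.
exact: tkernel'_le.
Qed.

Lemma atomless x : Q [set x] = 0%E.
Proof.
apply/eqP; rewrite eq_le measure_ge0 andbT; apply/lee_addgt0Pr => e e0.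
rewrite add0e; have d0 : 0 < e / (M + 1) by rewrite divr_gt0// ltr_wpDl.
apply: (@le_trans _ _ (Q [set y | `|x - y| <= e / (M + 1)])).
  apply: le_measure; rewrite ?inE//.
    rewrite (_ : [set y | _] = [set y | (fun y => `|x - y| <= e / (M + 1)) y = true])//.
    have : measurable_fun setT (fun y : RB => `|x - y| <= e / (M + 1)).
      by apply: measurable_fun_ler => //; apply: measurableT_comp.
    by move=> /(_ measurableT [set true]); rewrite setTI; apply.
  by move=> y /= ->; rewrite subrr normr0 ltW.
apply: le_trans (Q_ball _ d0) _; rewrite lee_fin mulrCA ler_piMr ?ltW//.
by rewrite ltr_pdivrMr ?ltr_wpDl// mul1r ltrDl.
Qed.

Lemma ae_neq x (B : RB -> Prop) : (forall y, y != x -> B y) ->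
  {ae Q, forall y, B y}.
Proof.
move=> hB; exists [set x]; split => //; first exact: atomless.
by move=> y /= nB; apply: contrapT => /eqP yx; apply: nB; exact: hB.
Qed.

(** Dominated convergence along sequences: the quotients are bounded by the Lipschitz constant
    [tlip e] and converge for [y != x], hence almost everywhere as [Q] has no atoms. *)
Lemma tpotential_is_derive e x : 0 < e ->
  is_derive x 1 (tpotential e) (tpotential' e x).
Proof.
move=> e0; apply/is_derive1_cvgP/cvgr_dnbhsP => h [h0 hn].
pose f n (y : RB) := (h n)^-1 * (tkernel e (x + h n - y) - tkernel e (x - y)).
have -> : (fun n => (h n)^-1 * (tpotential e (x + h n) - tpotential e x)) =
    (fun n => \int[Q]_y f n y).
  apply/funext => n; rewrite /tpotential -RintegralB//; [|exact: integrable_tkernel..].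
  rewrite -RintegralZl//.
  rewrite /comp; under eq_fun do rewrite EFinB.
  by apply: integrableB => //; exact: integrable_tkernel.
have mf n : measurable_fun setT (EFin \o f n).
  apply/measurable_EFinP; apply: measurable_funM => //.
  by apply: measurable_funB; exact: measurable_tkernel_shift.
have mf' : measurable_fun setT (EFin \o (fun y : RB => tkernel' e (x - y))).
  by apply/measurable_EFinP; exact: measurable_tkernel'_shift.
have f_cvg : {ae Q, forall y : RB, setT y ->
    (EFin \o f n) y @[n --> \oo] --> (EFin \o (fun y : RB => tkernel' e (x - y))) y}.
  apply: (@ae_neq x) => y yx _; apply: cvg_EFin; first exact: nearW.
  have xy0 : x - y != 0 by rewrite subr_eq0 eq_sym.
  have := tkernel_quotient_cvg kap_le0 b_le0 tangent e0 xy0 h0 hn.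
  by under eq_fun do rewrite addrAC.
have ig : Q.-integrable setT (EFin \o cst (tlip e)).
  exact: finite_measure_integrable_cst.
have f_le : {ae Q, forall (y : RB) n, setT y ->
    (`|(EFin \o f n) y| <= (EFin \o cst (tlip e)) y)%E}.
  apply: aeW => y n _ /=; rewrite lee_fin normrM normfV.
  rewrite mulrC ler_pdivrMr ?normr_gt0//.
  apply: le_trans (tkernel_lip kap_le0 b_le0 tangent _ _ e0) _.
  by rewrite (_ : x + h n - y - (x - y) = h n)//; ring.
have [_ _] := dominated_convergence measurableT mf mf' f_cvg ig f_le.
have fin : (\int[Q]_y (EFin \o (fun y : RB => tkernel' e (x - y))) y)%E \is a fin_num.
  by apply: integrable_fin_num => //; exact: integrable_tkernel'.
by rewrite -(fineK fin) => /fine_cvg.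
Qed.

Lemma tpotential_diff e e' x : 0 < e' -> e' <= e ->
  0 <= tpotential e' x - tpotential e x <= tlip e' * e * (M * e).
Proof.
move=> e'0 ee; have e0 := lt_le_trans e'0 ee.
rewrite /tpotential -RintegralB//; try exact: integrable_tkernel.
have bnd y := tkernel_diff kap_le0 b_le0 tangent (x - y) e'0 ee.
apply/andP; split.
  by apply: Rintegral_ge0 => y _; have /andP[] := bnd y.
have mB : measurable [set y : RB | `|x - y| <= e].
  have : measurable_fun setT (fun y : RB => `|x - y| <= e).
    by apply: measurable_fun_ler => //; apply: measurableT_comp.
  by move=> /(_ measurableT [set true]); rewrite setTI; apply.
apply: (@le_trans _ _ (\int[Q]_y (tlip e' * e * \1_[set y | `|x - y| <= e] y))).
  apply: le_Rintegral => //.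
  - rewrite /comp; under eq_fun do rewrite EFinB.
    by apply: integrableB => //; exact: integrable_tkernel.
  - rewrite /comp; under eq_fun do rewrite EFinM.
    by apply: integrableZl => //; exact: integrable_indic.
  - move=> y _; have /andP[_] := bnd y; rewrite indicE.
    by rewrite mem_setE.
rewrite RintegralZl//; last exact: integrable_indic.
rewrite ler_wpM2l ?(mulr_ge0 _ (ltW e0)) ?tlip_ge0//.
rewrite -lee_fin; apply: le_trans (Q_ball x e0).
by rewrite /Rintegral integral_indic// setIT fineK// fin_num_measure.
Qed.

(** The difference of two truncated derivatives is odd and vanishes off a ball of radius [e], which
    is the situation of [Q_odd]. *)
Lemma tpotential'_diff e e' x : 0 < e' -> e' <= e ->
  `|tpotential' e' x - tpotential' e x| <= tlip e' * (C * e `^ alpha * e).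
Proof.
move=> e'0 ee; have e0 := lt_le_trans e'0 ee.
rewrite /tpotential' -RintegralB//; try exact: integrable_tkernel'.
apply: (@Q_odd (fun z => tkernel' e' z - tkernel' e z)) => //.
- by apply: measurable_funB; exact: measurable_tkernel'.
- exact: tlip_ge0.
- by move=> z; rewrite !tkernel'N opprB opprK addrC.
- by move=> z; exact: tkernel'_diff.
Qed.

(* At dyadic scales the bounds on the increments of the potentials are
   geometric, so no singular integral has to be estimated. *)
Hypothesis b_gtN2 : -2 < b.
Hypothesis alpha_b : 0 < b + alpha + 1.

Definition cutoff n : R := 2^-1 ^+ n.

Lemma cutoff_gt0 n : 0 < cutoff n.
Proof. by rewrite exprn_gt0// invr_gt0. Qed.

Lemma cutoff_nincr m n : (m <= n)%N -> cutoff n <= cutoff m.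
Proof.
move=> mn; apply: ler_wiXn2l => //; lra.
Qed.

Let cutoffS n : cutoff n.+1 <= cutoff n. Proof. exact: cutoff_nincr. Qed.

Let powR_cutoff n p : cutoff n `^ p = (2^-1 `^ p) ^+ n.
Proof.
have h0 : 0 <= 2^-1 :> R by rewrite invr_ge0.
rewrite /cutoff -(powR_mulrn n h0) -powRrM mulrC powRrM.
by rewrite (powR_mulrn n (powR_ge0 _ _)).
Qed.

Let powR_half_lt1 p : 0 < p -> 2^-1 `^ p < 1 :> R.
Proof.
move=> p0; apply: (@lt_le_trans _ _ (1 `^ p)); last by rewrite powR1.
by apply: gt0_ltr_powR => //; rewrite ?nnegrE ?invr_ge0// invf_lt1// ltr1n.
Qed.

Let w : R := 2^-1 `^ b.

Let tlip_cutoff n : tlip (cutoff n) = - kap * w ^+ n.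
Proof. by rewrite -[LHS]/(- (kap * cutoff n `^ b)) powR_cutoff mulNr. Qed.

(** For [e = 2^-n] and [e' = e / 2], [tlip e' = - kap * w^(n + 1)]. The bound of [tpotential_diff]
    is therefore [A1 * (w / 4)^n], and [w / 4 = q1]; in the same way [tpotential'_diff] yields the
    ratio [q2]. The hypotheses [b_gtN2] and [alpha_b] say that both ratios are below 1. *)
Let A1 := - kap * w * M.
Let q1 : R := 2^-1 `^ (b + 2).
Let A2 := - kap * w * C.
Let q2 : R := 2^-1 `^ (b + alpha + 1).

Let half_neq0 : (2^-1 : R) != 0. Proof. by rewrite invr_eq0. Qed.

Let tpotential_incr x n :
  `|tpotential (cutoff n.+1) x - tpotential (cutoff n) x| <= A1 * q1 ^+ n.
Proof.
have /andP[d0 d1] := tpotential_diff x (cutoff_gt0 n.+1) (cutoffS n).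
rewrite ger0_norm//; apply: le_trans d1 _.
rewrite tlip_cutoff le_eqVlt; apply/orP; left; apply/eqP.
have -> : q1 = w * (2^-1 * 2^-1).
  by rewrite /q1 powRD ?half_neq0 ?implybT// -/w powR_mulrn ?invr_ge0// expr2.
by rewrite /A1 !exprMn exprS /cutoff; ring.
Qed.

Let tpotential'_incr x n :
  `|tpotential' (cutoff n.+1) x - tpotential' (cutoff n) x| <= A2 * q2 ^+ n.
Proof.
apply: le_trans (tpotential'_diff x (cutoff_gt0 n.+1) (cutoffS n)) _.
rewrite tlip_cutoff le_eqVlt; apply/orP; left; apply/eqP.
rewrite /q2 /A2 !powRD ?half_neq0 ?implybT// -/w powRr1 ?invr_ge0//.
by rewrite powR_cutoff !exprMn exprS /cutoff; ring.
Qed.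

Let A1_ge0 : 0 <= A1. Proof. by rewrite !mulr_ge0 ?oppr_ge0 ?powR_ge0. Qed.
Let A2_ge0 : 0 <= A2. Proof. by rewrite !mulr_ge0 ?oppr_ge0 ?powR_ge0. Qed.
Let q1_ge0 : 0 <= q1. Proof. exact: powR_ge0. Qed.
Let q2_ge0 : 0 <= q2. Proof. exact: powR_ge0. Qed.
Let q1_lt1 : q1 < 1. Proof. by apply: powR_half_lt1; rewrite -ltrBlDr sub0r. Qed.
Let q2_lt1 : q2 < 1. Proof. exact: powR_half_lt1. Qed.

Definition limpotential x := limn (fun n => tpotential (cutoff n) x).
Definition limpotential' x := limn (fun n => tpotential' (cutoff n) x).
Definition rate n := A1 / (1 - q1) * q1 ^+ n.
Definition rate' n := A2 / (1 - q2) * q2 ^+ n.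

Lemma rate_cvg0 : rate n @[n --> \oo] --> 0.
Proof. by apply: cvg_geometric; rewrite ger0_norm. Qed.

Lemma rate'_cvg0 : rate' n @[n --> \oo] --> 0.
Proof. by apply: cvg_geometric; rewrite ger0_norm. Qed.

Lemma limpotential_rate n x :
  `|limpotential x - tpotential (cutoff n) x| <= rate n.
Proof.
exact: (@geometric_increments_lim _ _ A1 q1 A1_ge0 q1_ge0 q1_lt1 (tpotential_incr x)).
Qed.

Lemma limpotential'_rate n x :
  `|limpotential' x - tpotential' (cutoff n) x| <= rate' n.
Proof.
exact: (@geometric_increments_lim _ _ A2 q2 A2_ge0 q2_ge0 q2_lt1 (tpotential'_incr x)).
Qed.

Lemma tpotential_cvg x : tpotential (cutoff n) x @[n --> \oo] --> limpotential x.
Proof.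
exact: (@geometric_increments_cvg _ _ A1 q1 A1_ge0 q1_ge0 q1_lt1 (tpotential_incr x)).
Qed.

Lemma limpotential_is_derive x : is_derive x 1 limpotential (limpotential' x).
Proof.
apply: (is_derive_lim (fun n x => tpotential_is_derive x (cutoff_gt0 n)) tpotential_cvg
  limpotential'_rate rate'_cvg0).
Qed.

Lemma tpotential'_le n x : `|tpotential' (cutoff n) x| <= tlip (cutoff n).
Proof.
have e0 := cutoff_gt0 n.
apply: le_trans (le_normr_Rintegral _ _) _ => //; first exact: integrable_tkernel'.
apply: (@le_trans _ _ (\int[Q]_y tlip (cutoff n))).
  apply: le_Rintegral => //.
  - have := integrable_tkernel' x e0 => /integrable_abse.
    by apply: eq_integrable => // y _.
  - exact: finite_measure_integrable_cst.
  - by move=> y _; exact: tkernel'_le.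
rewrite Rintegral_cst// -[leRHS]mulr1 ler_wpM2l ?tlip_ge0//.
by rewrite -lee_fin fineK ?fin_num_measure// probability_le1.
Qed.

(** Comparison with the scale [cutoff 0 = 1]. This bound makes the limiting work integrable and the
    dissipation finite. *)
Lemma limpotential'_bounded x : `|limpotential' x| <= rate' 0 + tlip 1.
Proof.
rewrite -[limpotential' x](subrK (tpotential' (cutoff 0) x)).
apply: le_trans (ler_normD _ _) (lerD (limpotential'_rate _ _) _).
exact: tpotential'_le.
Qed.

Variable Wf : R -> \bar R.
Hypothesis measurable_W : measurable_fun setT Wf.
Hypothesis W_neq0 : forall x, x != 0 -> Wf x = (k `|x|)%:E.
(** The value at 0 is not governed by [k], and an interaction energy sees it when the law has atoms;
    the truncated kernels have to lie below [Wf] there too. *)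
Hypothesis W0_ge : forall e, 0 < e -> ((tkernel e 0)%:E <= Wf 0)%E.

Lemma tkernel_le_W e x : 0 < e -> ((tkernel e x)%:E <= Wf x)%E.
Proof.
move=> e0; have [->|x0] := eqVneq x 0; first exact: W0_ge.
by rewrite W_neq0// lee_fin; apply: tprofile_le_profile; rewrite // normr_gt0.
Qed.

(** The truncated kernels may change sign. Subtracting the one at scale [cutoff 0] leaves a
    nonnegative nondecreasing sequence, fit for monotone convergence. *)
Let increment x n (y : RB) :=
  (tkernel (cutoff n) (x - y) - tkernel (cutoff 0) (x - y))%:E.

Let increment_ge0 x n y : (0 <= increment x n y)%E.
Proof.
rewrite lee_fin; have /andP[//] := tkernel_diff kap_le0 b_le0 tangent (x - y)
  (cutoff_gt0 n) (cutoff_nincr (leq0n n)).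
Qed.

Let increment_nd x y : {homo (increment x)^~ y : m n / (m <= n)%N >-> (m <= n)%E}.
Proof.
move=> m n mn; rewrite lee_fin -subr_ge0.
have -> : tkernel (cutoff n) (x - y) - tkernel (cutoff 0) (x - y) -
    (tkernel (cutoff m) (x - y) - tkernel (cutoff 0) (x - y)) =
    tkernel (cutoff n) (x - y) - tkernel (cutoff m) (x - y) by ring.
by have /andP[] := tkernel_diff kap_le0 b_le0 tangent (x - y)
  (cutoff_gt0 n) (cutoff_nincr mn).
Qed.

Let measurable_increment x n : measurable_fun setT (increment x n).
Proof.
apply/measurable_EFinP; apply: measurable_funB; apply: measurable_tkernel_shift;
  exact: cutoff_gt0.
Qed.

Let increment_cvg x (y : RB) : y != x -> increment x n y @[n --> \oo] -->
  (Wf (x - y) - (tkernel (cutoff 0) (x - y))%:E)%E.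
Proof.
move=> yx; have xy0 : 0 < `|x - y| by rewrite normr_gt0 subr_eq0 eq_sym.
rewrite W_neq0 -?normr_gt0//.
(* The truncation no longer affects the value at [x - y] once [cutoff n < |x - y|]. *)
apply: cvg_near_cst.
have c0 : cutoff n @[n --> \oo] --> 0.
  apply: (@cvg_expr _ 2^-1); rewrite ger0_norm; lra.
have : \forall n \near \oo, cutoff n < `|x - y| by exact: cvgr_lt c0 _ xy0.
apply: filterS => n nxy; apply/eqP.
by rewrite /increment [tkernel (cutoff n) _]tprofile_big// EFinB.
Qed.

Let integral_increment x : (\int[Q]_y limn (increment x ^~ y) =
  (limpotential x - tpotential (cutoff 0) x)%:E)%E.
Proof.
rewrite monotone_convergence//.
apply/cvg_lim => //.
rewrite (_ : (fun n => _) = (fun n => (tpotential (cutoff n) x - tpotential (cutoff 0) x)%:E)).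
  apply: cvg_EFin; first exact: nearW.
  by apply: cvgB; [exact: tpotential_cvg|exact: cvg_cst].
apply/funext => n; rewrite EFinB /tpotential /Rintegral.
rewrite !fineK; [|apply: integrable_fin_num => //; apply: integrable_tkernel;
  exact: cutoff_gt0..].
rewrite -integralB//; by apply: integrable_tkernel; exact: cutoff_gt0.
Qed.

Let excess x (y : RB) := (Wf (x - y) - (tkernel (cutoff 0) (x - y))%:E)%E.

Let excess_ge0 x y : (0 <= excess x y)%E.
Proof. by rewrite sube_ge0 ?fin_numE//; apply: tkernel_le_W; exact: cutoff_gt0. Qed.

(* Monotone convergence; W may be infinite at 0, hence the almost everywhere
   identification of the limit. *)
Lemma integral_W_excess x :
  (\int[Q]_y (Wf (x - y) - (tkernel (cutoff 0) (x - y))%:E) =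
   (limpotential x - tpotential (cutoff 0) x)%:E)%E.
Proof.
rewrite -integral_increment; apply: ae_eq_integral => //.
- apply: emeasurable_funB; first exact: (measurableT_comp measurable_W).
  apply/measurable_EFinP; apply: measurable_tkernel_shift; exact: cutoff_gt0.
- apply: (emeasurable_fun_cvg (increment x)) => // y _.
  apply: ereal_nondecreasing_is_cvgn; exact: increment_nd.
apply: (@ae_neq x) => y yx _; apply/esym/cvg_lim => //.
exact: increment_cvg.
Qed.

Lemma integral_W x : (\int[Q]_y Wf (x - y) = (limpotential x)%:E)%E.
Proof.
have mG : measurable_fun setT (excess x).
  apply: emeasurable_funB; first exact: (measurableT_comp measurable_W).
  apply/measurable_EFinP; apply: measurable_tkernel_shift; exact: cutoff_gt0.
have IG : (\int[Q]_y excess x y = (limpotential x - tpotential (cutoff 0) x)%:E)%E.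
  exact: integral_W_excess.
have iG : Q.-integrable setT (excess x).
  apply/integrableP; split => //.
  by under eq_integral do rewrite gee0_abs//; rewrite IG ltry.
have -> : (fun y => Wf (x - y)) =
    (fun y => excess x y + (tkernel (cutoff 0) (x - y))%:E)%E.
  by apply/funext => y; rewrite /excess subeK.
have iK := integrable_tkernel x (cutoff_gt0 0).
rewrite integralD// IG EFinB.
have -> : (\int[Q]_y (tkernel (cutoff 0) (x - y))%:E = (tpotential (cutoff 0) x)%:E)%E.
  by rewrite /tpotential /Rintegral fineK//; apply: integrable_fin_num.
by rewrite subeK.
Qed.

Lemma continuous_limpotential : continuous limpotential.
Proof.
move=> x; apply: differentiable_continuous; apply/derivable1_diffP.
by have [] := limpotential_is_derive x.
Qed.

(** * Interaction energies along a comonotone pair *)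

Section comonotone.
Context d (T : measurableType d) (P : probability T R).
Variables (nu : probability RB R) (X Y : T -> RB).
Hypotheses (mX : measurable_fun setT X) (mY : measurable_fun setT Y).
Hypothesis lawX : forall A, measurable A -> P (X @^-1` A) = Q A.
Hypothesis lawY : forall A, measurable A -> P (Y @^-1` A) = nu A.
Hypothesis iX : P.-integrable setT (fun u => (X u : R)%:E).
Hypothesis iY : P.-integrable setT (fun u => (Y u : R)%:E).
Hypothesis XY : forall u v, 0 <= ((X u : R) - X v) * ((Y u : R) - Y v).

Let g (u : T) : R := (Y u : R) - X u.

Let ig : P.-integrable setT (fun u => (g u)%:E).
Proof. by under eq_fun do rewrite EFinB; exact: integrableB. Qed.

Let mg : measurable_fun setT g. Proof. exact: measurable_funB. Qed.

Let measurable_fst_rv (Z : T -> RB) : measurable_fun setT Z ->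
  measurable_fun setT (fun z : T * T => Z z.1 : R).
Proof. by move=> mZ; exact: measurableT_comp. Qed.

Let measurable_snd_rv (Z : T -> RB) : measurable_fun setT Z ->
  measurable_fun setT (fun z : T * T => Z z.2 : R).
Proof. by move=> mZ; exact: measurableT_comp. Qed.

Let measurable_diff (Z : T -> RB) : measurable_fun setT Z ->
  measurable_fun setT (fun z : T * T => (Z z.1 : R) - Z z.2).
Proof.
by move=> mZ; apply: measurable_funB; [exact: measurable_fst_rv|exact: measurable_snd_rv].
Qed.

Let integrable_tkernel_diff e (Z : T -> RB) : 0 < e -> measurable_fun setT Z ->
  P.-integrable setT (fun u => (Z u : R)%:E) ->
  (P \x P)%E.-integrable setT (fun z => (tkernel e ((Z z.1 : R) - Z z.2))%:E).
Proof.
move=> e0 mZ iZ.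
have iZa : P.-integrable setT (fun u => `|Z u : R|%:E) by exact: (integrable_abse iZ).
have ib : (P \x P)%E.-integrable setT (fun z =>
    (`|tkernel e 0| + tlip e * (`|Z z.1 : R| + `|Z z.2 : R|))%:E).
  under eq_fun do rewrite EFinD EFinM EFinD.
  apply: integrableD => //.
    exact: (@integrable_fst _ _ _ P (fun=> `|tkernel e 0|%:E)
      (finite_measure_integrable_cst P _ measurableT)).
  apply: integrableZl => //; apply: integrableD => //.
  - exact: (integrable_fst iZa).
  - exact: (integrable_snd iZa).
apply: le_integrable ib => //.
  apply/measurable_EFinP.
  apply: (measurableT_comp (measurable_tkernel kap_le0 b_le0 tangent e0)).
  exact: measurable_diff.
move=> [u v] _ /=; rewrite lee_fin [leRHS]ger0_norm; last first.
  by rewrite addr_ge0// mulr_ge0 ?tlip_ge0 ?addr_ge0.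
have h := tkernel_lip kap_le0 b_le0 tangent ((Z u : R) - Z v) 0 e0.
rewrite subr0 in h.
have h2 : tlip e * `|(Z u : R) - Z v| <= tlip e * (`|Z u : R| + `|Z v : R|).
  by rewrite ler_wpM2l ?tlip_ge0// ler_normB.
rewrite -[X in `|X| <= _](subrK (tkernel e 0)) addrC.
apply: le_trans (ler_normD _ _) _; lra.
Qed.

(** By oddness [tkernel' e (X u - X v) * (g u - g v)] is the sum of [slope_fst] and [slope_snd];
    integrating out the other variable turns each of them into [work e]. *)
Let slope_fst e (z : T * T) := tkernel' e ((X z.1 : R) - X z.2) * g z.1.

Let slope_snd e (z : T * T) := tkernel' e ((X z.2 : R) - X z.1) * g z.2.

Let measurable_tkernel'_diff e : 0 < e ->
  measurable_fun setT (fun z : T * T => tkernel' e ((X z.1 : R) - X z.2)).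
Proof.
move=> e0; apply: (measurableT_comp (measurable_tkernel' kap b e0)).
exact: measurable_diff.
Qed.

Let integrable_slope_fst e : 0 < e ->
  (P \x P)%E.-integrable setT (EFin \o slope_fst e).
Proof.
move=> e0; have ib : (P \x P)%E.-integrable setT (fun z => (tlip e * `|g z.1|)%:E).
  under eq_fun do rewrite EFinM; apply: integrableZl => //.
  exact: (integrable_fst (integrable_abse ig)).
apply: le_integrable ib => //.
  apply/measurable_EFinP; apply: measurable_funM.
    exact: measurable_tkernel'_diff.
  exact: (measurable_fst_rv mg).
move=> [u v] _ /=; rewrite lee_fin normrM [leRHS]ger0_norm ?mulr_ge0 ?tlip_ge0//.
by rewrite ler_wpM2r// tkernel'_le.
Qed.

Let integrable_slope_snd e : 0 < e ->
  (P \x P)%E.-integrable setT (EFin \o slope_snd e).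
Proof.
move=> e0; have ib : (P \x P)%E.-integrable setT (fun z => (tlip e * `|g z.2|)%:E).
  under eq_fun do rewrite EFinM; apply: integrableZl => //.
  exact: (integrable_snd (integrable_abse ig)).
apply: le_integrable ib => //.
  apply/measurable_EFinP; apply: measurable_funM.
    rewrite (_ : (fun _ => _) = (fun z : T * T => - tkernel' e ((X z.1 : R) - X z.2))).
      exact: measurableT_comp (measurable_tkernel'_diff e0).
    by apply/funext => z; rewrite -tkernel'N opprB.
  exact: (measurable_snd_rv mg).
move=> [u v] _ /=; rewrite lee_fin normrM [leRHS]ger0_norm ?mulr_ge0 ?tlip_ge0//.
by rewrite ler_wpM2r// tkernel'_le.
Qed.

Let integral_tkernel'_law e x : 0 < e ->
  (\int[P]_v (tkernel' e (x - X v))%:E = (tpotential' e x)%:E)%E.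
Proof.
move=> e0; rewrite /tpotential' /Rintegral fineK; last first.
  by apply: integrable_fin_num => //; exact: integrable_tkernel'.
rewrite (@integral_law _ _ _ _ _ P Q X)//.
by apply/measurable_EFinP; exact: measurable_tkernel'_shift.
Qed.

Definition work e := \int[P]_u (tpotential' e (X u) * g u).

Let integral_slice e u : 0 < e ->
  (\int[P]_v (tkernel' e ((X u : R) - X v) * g u)%:E =
   (tpotential' e (X u) * g u)%:E)%E.
Proof.
move=> e0; under eq_integral do rewrite mulrC EFinM.
rewrite integralZl//; last first.
  apply/(@integrable_law _ _ _ _ _ P Q X mX lawX
    (fun y : RB => (tkernel' e ((X u : R) - y))%:E)).
    by apply/measurable_EFinP; exact: measurable_tkernel'_shift.
  exact: integrable_tkernel'.
by rewrite integral_tkernel'_law// -EFinM mulrC.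
Qed.

Let integral_slope_fst e : 0 < e -> \int[(P \x P)%E]_z slope_fst e z = work e.
Proof.
move=> e0; rewrite /Rintegral -integral12_prod_meas1; last exact: integrable_slope_fst.
by congr fine; apply: eq_integral => u _; exact: integral_slice.
Qed.

Let integral_slope_snd e : 0 < e -> \int[(P \x P)%E]_z slope_snd e z = work e.
Proof.
move=> e0; rewrite /Rintegral -integral21_prod_meas1; last exact: integrable_slope_snd.
by congr fine; apply: eq_integral => u _; exact: integral_slice.
Qed.

(** The section at [u] is the event [X v = X u], whose probability is that of a single point under
    [Q]. *)
Let diagonal_null : (P \x P)%E [set z | (X z.1 : R) == X z.2] = 0%E.
Proof.
rewrite /product_measure1; apply: integral0_eq => u _.
rewrite /= (_ : xsection _ _ = X @^-1` [set X u]) ?lawX ?atomless//.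
by apply/seteqP; split=> v; rewrite /xsection/= inE/=; [move=> /eqP ->|move=> ->].
Qed.

Lemma comonotone_tkernel e : 0 < e ->
  \int[(P \x P)%E]_z tkernel e ((X z.1 : R) - X z.2) + 2 * work e <=
  \int[(P \x P)%E]_z tkernel e ((Y z.1 : R) - Y z.2).
Proof.
move=> e0.
have iKX := integrable_tkernel_diff e0 mX iX.
have iKY := integrable_tkernel_diff e0 mY iY.
have i1 := integrable_slope_fst e0; have i2 := integrable_slope_snd e0.
rewrite -subr_ge0 mulr2n mulrDl mul1r.
rewrite -{1}(integral_slope_fst e0) -(integral_slope_snd e0).
rewrite -RintegralD// -RintegralD//; last first.
  by rewrite /comp; under eq_fun do rewrite EFinD; exact: integrableD.
have i12 : (P \x P)%E.-integrable setT (EFin \o (fun z =>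
    tkernel e ((X z.1 : R) - X z.2) + (slope_fst e z + slope_snd e z))).
  rewrite /comp; under eq_fun do rewrite EFinD EFinD.
  by apply: integrableD => //; exact: integrableD.
rewrite -RintegralB//.
apply: (@ae_ge0_Rintegral _ _ _ _ _ [set z | (X z.1 : R) == X z.2]).
- by rewrite /comp; under eq_fun do rewrite EFinB; exact: integrableB.
- have : measurable_fun setT (fun z : T * T => (X z.1 : R) == X z.2).
    by apply: measurable_fun_eqr; [exact: measurable_fst_rv|exact: measurable_snd_rv].
  by move=> /(_ measurableT [set true]); rewrite setTI; apply.
- exact: diagonal_null.
- move=> [u v] /= /negP xuv; rewrite subr_ge0.
  have x0 : (X u : R) - X v != 0 by rewrite subr_eq0.
  have := tkernel_tangent kap_le0 b_le0 tangent e0 x0 (XY u v).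
  rewrite /slope_fst /slope_snd/= -(opprB (X u : R)) tkernel'N /g; lra.
Qed.

Let integral_tkernel_law e x : 0 < e ->
  (\int[P]_v (tkernel e (x - X v))%:E = (tpotential e x)%:E)%E.
Proof.
move=> e0; rewrite /tpotential /Rintegral fineK; last first.
  by apply: integrable_fin_num => //; exact: integrable_tkernel.
rewrite (@integral_law _ _ _ _ _ P Q X)//.
by apply/measurable_EFinP; exact: measurable_tkernel_shift.
Qed.

Let integrable_tpotential_rv e : 0 < e ->
  P.-integrable setT (fun u => (tpotential e (X u))%:E).
Proof.
move=> e0; have := integrable_fubini_F (integrable_tkernel_diff e0 mX iX).
by apply: eq_integrable => // u _; rewrite /fubini_F/= integral_tkernel_law.
Qed.

Let integral_tkernel_prod e : 0 < e ->
  (\int[P \x P]_z (tkernel e ((X z.1 : R) - X z.2))%:E =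
   \int[P]_u (tpotential e (X u))%:E)%E.
Proof.
move=> e0; rewrite -integral12_prod_meas1; last exact: integrable_tkernel_diff.
by apply: eq_integral => u _; rewrite /fubini_F/= integral_tkernel_law.
Qed.

Let measurable_limpotential_rv : measurable_fun setT (fun u => limpotential (X u)).
Proof.
apply: (measurableT_comp _ mX).
by apply: continuous_measurable_fun; exact: continuous_limpotential.
Qed.

Let integrable_limpotential_diff :
  P.-integrable setT (fun u => (limpotential (X u) - tpotential (cutoff 0) (X u))%:E).
Proof.
have it := integrable_tpotential_rv (cutoff_gt0 0).
have ir : P.-integrable setT (EFin \o cst (rate 0)).
  exact: (finite_measure_integrable_cst P _ measurableT).
apply: le_integrable ir => //.
  apply/measurable_EFinP; apply: measurable_funB => //.
  by apply/measurable_EFinP; exact: measurable_int it.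
move=> u _ /=; rewrite lee_fin; apply: le_trans (ler_norm _).
exact: limpotential_rate.
Qed.

Lemma integrable_limpotential : P.-integrable setT (fun u => (limpotential (X u))%:E).
Proof.
have := integrableD measurableT integrable_limpotential_diff
  (integrable_tpotential_rv (cutoff_gt0 0)).
by apply: eq_integrable => // u _; rewrite -EFinD subrK.
Qed.

(** [Wf] may be unbounded with both signs, so Tonelli is applied to its nonnegative excess [G] over
    the kernel at scale [cutoff 0]; this integrable kernel is then added back by Fubini. *)
Lemma interaction_limpotential :
  (\int[Q \x Q]_z Wf ((z.1 : R) - z.2) = (\int[P]_u limpotential (X u))%:E)%E.
Proof.
have mW2 : measurable_fun setT (fun z : RB * RB => Wf ((z.1 : R) - z.2)).
  by apply: (measurableT_comp measurable_W); exact: measurable_funB.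
have mWX : measurable_fun setT (fun z : T * T => Wf ((X z.1 : R) - X z.2)).
  by apply: (measurableT_comp measurable_W); exact: measurable_diff.
rewrite (integral_law (measurable_square_map mX) (product_law mX lawX))//=.
have c0 := cutoff_gt0 0.
have iK := integrable_tkernel_diff c0 mX iX.
have iU := integrable_limpotential_diff.
pose G (z : T * T) := (Wf ((X z.1 : R) - X z.2) -
  (tkernel (cutoff 0) ((X z.1 : R) - X z.2))%:E)%E.
have mG : measurable_fun setT G.
  by apply: emeasurable_funB => //; exact: measurable_int iK.
have G0 z : (0 <= G z)%E.
  by rewrite sube_ge0 ?fin_numE//; exact: tkernel_le_W.
have IG : (\int[P \x P]_z G z =
    \int[P]_u (limpotential (X u) - tpotential (cutoff 0) (X u))%:E)%E.
  rewrite fubini_tonelli1//; apply: eq_integral => u _.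
  rewrite -integral_W_excess (integral_law mX lawX)//.
  apply: emeasurable_funB; first exact: (measurableT_comp measurable_W).
  by apply/measurable_EFinP; exact: measurable_tkernel_shift.
have iG : (P \x P)%E.-integrable setT G.
  apply/integrableP; split => //.
  under eq_integral do rewrite gee0_abs//; rewrite IG.
  by rewrite ltey_eq integrable_fin_num.
have -> : (fun z => Wf ((X z.1 : R) - X z.2)) =
    (fun z => G z + (tkernel (cutoff 0) ((X z.1 : R) - X z.2))%:E)%E.
  by apply/funext => z; rewrite /G subeK.
have it := integrable_tpotential_rv c0.
rewrite integralD// IG integral_tkernel_prod// -integralD//.
under eq_integral do rewrite -EFinD subrK.
by rewrite /Rintegral fineK// integrable_fin_num//; exact: integrable_limpotential.
Qed.

Let Rintegral_rate (f h r : T -> R) c :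
  P.-integrable setT (EFin \o f) -> P.-integrable setT (EFin \o h) ->
  P.-integrable setT (EFin \o r) -> (forall u, `|f u - h u| <= c * r u) ->
  `|\int[P]_u f u - \int[P]_u h u| <= c * \int[P]_u r u.
Proof.
move=> fi hi ri le; rewrite -RintegralB// -RintegralZl//.
have fhi : P.-integrable setT (EFin \o (fun u => f u - h u)).
  by rewrite /comp; under eq_fun do rewrite EFinB; exact: integrableB.
apply: le_trans (le_normr_Rintegral _ _) _ => //.
apply: le_Rintegral => //.
  by have := integrable_abse fhi; apply: eq_integrable => // u _.
by rewrite /comp; under eq_fun do rewrite EFinM; exact: integrableZl.
Qed.

Let Rintegral_tkernel_cvg :
  \int[(P \x P)%E]_z tkernel (cutoff n) ((X z.1 : R) - X z.2) @[n --> \oo] -->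
  \int[P]_u limpotential (X u).
Proof.
apply/cvgrPdist_le => /= e e0; near=> n.
rewrite {2}/Rintegral integral_tkernel_prod ?cutoff_gt0// -/(Rintegral _ _ _).
apply: le_trans (@Rintegral_rate _ _ (cst 1) (rate n) _ _ _ _) _.
- exact: integrable_limpotential.
- by apply: integrable_tpotential_rv; exact: cutoff_gt0.
- exact: (finite_measure_integrable_cst P _ measurableT).
- by move=> u; rewrite mulr1; exact: limpotential_rate.
rewrite Rintegral_cst// mul1r [X in fine X]probability_setT mulr1.
by near: n; exact: cvgr_le rate_cvg0 _ e0.
Unshelve. all: by end_near. Qed.

Let mX' : measurable_fun setT (fun u => limpotential' (X u)).
Proof.
apply: (measurableT_comp _ mX); apply: measurable_is_derive.
exact: limpotential_is_derive.
Qed.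

Let integrable_work_lim : P.-integrable setT (EFin \o (fun u => limpotential' (X u) * g u)).
Proof.
have ib : P.-integrable setT (fun u => ((rate' 0 + tlip 1) * `|g u|)%:E).
  under eq_fun do rewrite EFinM; apply: integrableZl => //.
  exact: (integrable_abse ig).
apply: le_integrable ib => //.
  by apply/measurable_EFinP; exact: measurable_funM.
move=> u _ /=; rewrite lee_fin; apply: le_trans (ler_norm _).
by rewrite normrM ler_wpM2r//; exact: limpotential'_bounded.
Qed.

Let integrable_work n :
  P.-integrable setT (EFin \o (fun u => tpotential' (cutoff n) (X u) * g u)).
Proof.
have := integrable_fubini_F (integrable_slope_fst (cutoff_gt0 n)).
apply: eq_integrable => // u _.
by rewrite /fubini_F /slope_fst/= integral_slice ?cutoff_gt0.
Qed.

Let work_cvg :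
  work (cutoff n) @[n --> \oo] --> \int[P]_u (limpotential' (X u) * g u).
Proof.
have c : rate' n * \int[P]_u `|g u| @[n --> \oo] --> 0.
  by rewrite -[X in _ --> X](mul0r (\int[P]_u `|g u|)); apply: cvgMl; exact: rate'_cvg0.
apply/cvgrPdist_le => /= e e0; near=> n.
apply: le_trans (@Rintegral_rate _ _ (fun u => `|g u|) (rate' n) _ _ _ _) _.
- exact: integrable_work_lim.
- exact: integrable_work.
- exact: (integrable_abse ig).
- by move=> u; rewrite -mulrBl normrM ler_wpM2r//; exact: limpotential'_rate.
by near: n; exact: cvgr_le c _ e0.
Unshelve. all: by end_near. Qed.

(** On the [Y] side every truncated kernel is simply bounded by [Wf]. Only the [X] side passes to
    the limit, so the interaction energy of [nu] may be infinite. *)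
Theorem comonotone_interaction :
  ((\int[P]_u limpotential (X u) + 2 * \int[P]_u (limpotential' (X u) * g u))%:E <=
   \int[nu \x nu]_z Wf ((z.1 : R) - z.2))%E.
Proof.
have mW2 : measurable_fun setT (fun z : RB * RB => Wf ((z.1 : R) - z.2)).
  by apply: (measurableT_comp measurable_W); exact: measurable_funB.
have mWY : measurable_fun setT (fun z : T * T => Wf ((Y z.1 : R) - Y z.2)).
  by apply: (measurableT_comp measurable_W); exact: measurable_diff.
rewrite (integral_law (measurable_square_map mY) (product_law mY lawY))//=.
have lb n : ((\int[(P \x P)%E]_z tkernel (cutoff n) ((X z.1 : R) - X z.2) +
    2 * work (cutoff n))%:E <= \int[P \x P]_z Wf ((Y z.1 : R) - Y z.2))%E.
  have iK := integrable_tkernel_diff (cutoff_gt0 n) mY iY.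
  apply: (@le_trans _ _ (\int[P \x P]_z (tkernel (cutoff n) ((Y z.1 : R) - Y z.2))%:E)%E).
    rewrite -[leRHS]fineK ?integrable_fin_num// lee_fin.
    by apply: comonotone_tkernel; exact: cutoff_gt0.
  apply: integrable_le_integral => // z; exact: tkernel_le_W (cutoff_gt0 n).
have c : \int[(P \x P)%E]_z tkernel (cutoff n) ((X z.1 : R) - X z.2) +
    2 * work (cutoff n) @[n --> \oo] -->
    \int[P]_u limpotential (X u) + 2 * \int[P]_u (limpotential' (X u) * g u).
  by apply: cvgD; [exact: Rintegral_tkernel_cvg|apply: cvgMr; exact: work_cvg].
case: (\int[P \x P]_z Wf ((Y z.1 : R) - Y z.2))%E lb => [r| |] lb.
- rewrite lee_fin; apply: (ler_cvg_to c (cvg_cst r)).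
  by apply: nearW => n; have := lb n; rewrite lee_fin.
- by rewrite leey.
- by have := lb 0; rewrite leeNy_eq.
Qed.

End comonotone.

End truncated_potential.

(** * Hoelder densities *)

Lemma lebesgue_measure_reflect {R : realType} (c : R)
    (A : set (measurableTypeR R)) : measurable A ->
  lebesgue_measure ((fun y : measurableTypeR R => c - y : measurableTypeR R) @^-1` A) =
  lebesgue_measure A.
Proof.
move=> mA; apply/esym.
rewrite -[RHS]/(pushforward lebesgue_measure
  (fun y : measurableTypeR R => c - y : measurableTypeR R) A).
apply: lebesgue_measure_unique => //; first exact: measurable_funB.
move=> mX _ [[a b] _ <-]; rewrite /= /pushforward.
have -> : (fun y : R => c - y) @^-1` `]a, b] = `[c - b, c - a[%classic.
  by apply/seteqP; split=> y /=; rewrite !in_itv/= => /andP[? ?]; apply/andP; split; lra.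
rewrite !lebesgue_measure_itv/= !lte_fin.
rewrite ltrD2l ltrN2; case: ifPn => // _.
by rewrite -!EFinB; congr (_%:E); ring.
Qed.

(** The reflection [y -> 2 x - y] preserves Lebesgue measure and changes the sign of [D (x - y)], so
    the integral, finite by integrability, equals its opposite. *)
Lemma integral_odd {R : realType} (D : R -> R) (x : R) :
  measurable_fun setT D -> (forall z, D (- z) = - D z) ->
  (@lebesgue_measure R).-integrable setT (fun y => (D (x - y))%:E) ->
  (\int[lebesgue_measure]_y (D (x - y))%:E = 0)%E.
Proof.
move=> mD oD iD.
set I := (X in X = _).
have fI : I \is a fin_num by exact: integrable_fin_num.
have E : I = (- I)%E.
  rewrite {1}/I (@integral_law _ _ _ _ R lebesgue_measure lebesgue_measure
    (fun y : measurableTypeR R => x + x - y : measurableTypeR R)).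
  - rewrite /I -integralN//=.
      by apply: eq_integral => y _; rewrite -oD; congr (D _)%:E; ring.
    exact: integrable_add_def.
  - exact: measurable_funB.
  - exact: lebesgue_measure_reflect.
  - by apply/measurable_EFinP; apply: (measurableT_comp mD); exact: measurable_funB.
by move: E; rewrite -(fineK fI) -EFinN => -[E]; congr (_%:E); lra.
Qed.

Section holder_density.
Context {R : realType} (rho : R -> R) (alpha C : R).
Local Notation leb := (@lebesgue_measure R).
Local Notation RB := (measurableTypeR R).
Context (rho_L1 : leb.-integrable [set: R] (EFin \o rho))
        (rho_ge0 : forall x, 0 <= rho x)
        (rho_mass : (\int[leb]_x (rho x)%:E = 1)%E).
Hypothesis alpha_ge0 : 0 <= alpha.
Hypothesis C_ge0 : 0 <= C.
Hypothesis rho_holder : forall x y, `|rho x - rho y| <= C * `|x - y| `^ alpha.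
Local Notation P := (density_prob rho_L1 rho_ge0 rho_mass).

Let mrho : measurable_fun setT rho.
Proof. by have /measurable_int/measurable_EFinP := rho_L1. Qed.

Let holder_ball (x y e : R) : `|x - y| <= e -> `|rho x - rho y| <= C * e `^ alpha.
Proof.
move=> xye; apply: le_trans (rho_holder _ _) _; rewrite ler_wpM2l//.
by apply: ge0_ler_powR; rewrite ?nnegrE// (le_trans _ xye).
Qed.

(** On [[x, x + 1]] the density is at least [rho x - C], and its integral there is at most the total
    mass 1. *)
Lemma holder_density_le x : rho x <= 1 + C.
Proof.
have leb1 : leb `[x, (x + 1)%R] = 1%E.
  rewrite lebesgue_measure_itv/= lte_fin ltrDl ltr01 -EFinB.
  by congr (_%:E); ring.
rewrite -lerBlDr -lee_fin -rho_mass.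
apply: (@le_trans _ _ (\int[leb]_(y in `[x, (x + 1)%R]) (rho y)%:E)%E).
  apply: (@le_trans _ _ (\int[leb]_(y in `[x, (x + 1)%R]) (rho x - C)%:E)%E).
    by rewrite integral_cst// [X in (_ * X)%E]leb1 mule1.
  apply: le_integral => //.
  - apply/integrableP; split => //.
    by rewrite integral_cst//= [X in (_ * X)%E]leb1 mule1 ltry.
  - by apply: integrableS rho_L1.
  - move=> y; rewrite inE/= in_itv/= => /andP[xy yx]; rewrite lee_fin.
    have : `|x - y| <= 1 by rewrite ler_norml; apply/andP; split; lra.
    move=> /holder_ball; rewrite powR1 mulr1 ler_norml => /andP[_]; lra.
by apply: ge0_subset_integral => //; [apply/measurable_EFinP|move=> y _; rewrite lee_fin].
Qed.

Lemma lebesgue_measure_ball (x e : R) : 0 < e ->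
  leb [set y : RB | `|x - y| <= e] = (2 * e)%:E.
Proof.
move=> e0; have -> : [set y : RB | `|x - y| <= e] = `[x - e, x + e]%classic.
  apply/seteqP; split=> y /=; rewrite in_itv/= ler_norml => /andP[? ?].
    by apply/andP; split; lra.
  by apply/andP; split; lra.
rewrite lebesgue_measure_itv/= lte_fin.
by rewrite ifT; [rewrite -EFinB; congr (_%:E); ring|lra].
Qed.

Let measurable_ball_le (x e : R) : measurable [set y : RB | `|x - y| <= e].
Proof.
have : measurable_fun setT (fun y : RB => `|x - y| <= e).
  apply: measurable_fun_ler => //; apply: measurableT_comp => //.
  exact: measurable_funB.
by move=> /(_ measurableT [set true]); rewrite setTI; apply.
Qed.

Lemma holder_density_ball (x e : R) : 0 < e ->
  (P [set y : R | (`|x - y| <= e)%R] <= ((1 + C) * 2 * e)%:E)%E.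
Proof.
move=> e0; rewrite /density_prob.
apply: (@le_trans _ _ (\int[leb]_(y in [set y : RB | (`|x - y| <= e)%R]) (1 + C)%:E)%E).
  apply: ge0_le_integral => //.
  - by move=> y _; rewrite lee_fin.
  - by apply/measurable_EFinP; exact: measurable_funTS.
  - by move=> y _; rewrite lee_fin holder_density_le.
rewrite integral_cst// -mulrA EFinM.
by rewrite [X in (_ * X <= _)%E]lebesgue_measure_ball.
Qed.

(** [rho y] may be replaced with [rho y - rho x], as the constant [rho x] integrates to 0 against
    the odd [D]. This difference is at most [C * e ^ alpha] where [D (x - y)] can be nonzero, an
    interval of length [2 * e]. *)
Lemma holder_density_odd (D : R -> R) (L e x : R) : measurable_fun setT D ->
  0 < e -> 0 <= L -> (forall z, D (- z) = - D z) ->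
  (forall z, `|D z| <= L * (`|z| <= e)%R%:R) ->
  `|\int[P]_y D (x - y)| <= L * (2 * C * e `^ alpha * e).
Proof.
move=> mD e0 L0 oD bD.
have mDx : measurable_fun setT (fun y : RB => D (x - y)).
  by apply: (measurableT_comp mD); exact: measurable_funB.
pose ind (y : RB) : R := \1_[set y : RB | `|x - y| <= e] y.
have indE y : ind y = (`|x - y| <= e)%R%:R by rewrite /ind indicE mem_setE.
have i1 : leb.-integrable setT (EFin \o ind).
  apply/integrableP; split; first exact/measurable_EFinP/measurable_indic.
  under eq_integral => y _ do rewrite /= ger0_norm ?indE//.
  under eq_integral => y _ do rewrite -indE /ind.
  by rewrite integral_indic// setIT [X in (X < _)%E]lebesgue_measure_ball// ltry.
have iD : leb.-integrable setT (fun y => (D (x - y))%:E).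
  have iL : leb.-integrable setT (fun y => (L * ind y)%:E).
    by under eq_fun do rewrite EFinM; exact: integrableZl.
  apply: le_integrable iL => //; first exact/measurable_EFinP.
  move=> y _ /=; rewrite lee_fin [leRHS]ger0_norm ?mulr_ge0 ?indE//.
have iDx : leb.-integrable setT (fun y => (D (x - y) * rho x)%:E).
  by under eq_fun do rewrite mulrC EFinM; exact: integrableZl.
have bnd y : `|D (x - y) * (rho y - rho x)| <= L * (C * e `^ alpha) * ind y.
  rewrite normrM indE mulrAC.
  have := bD (x - y); case: (leP `|x - y| e) => xye h.
    by apply: ler_pM => //; rewrite distrC; exact: holder_ball.
  by move: h; rewrite mulr0 !mul0r normr_le0 => /eqP ->; rewrite normr0 mul0r.
have ib : leb.-integrable setT (fun y => (L * (C * e `^ alpha) * ind y)%:E).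
  by under eq_fun do rewrite EFinM; exact: integrableZl.
have iDr : leb.-integrable setT (fun y => (D (x - y) * (rho y - rho x))%:E).
  apply: le_integrable ib => //.
    apply/measurable_EFinP; apply: measurable_funM => //.
    exact: measurable_funB.
  move=> y _ /=; rewrite lee_fin; apply: le_trans (bnd y) _; exact: ler_norm.
have E : (\int[P]_y (D (x - y))%:E =
    \int[leb]_y (D (x - y) * (rho y - rho x))%:E)%E.
  rewrite integral_density; last exact/measurable_EFinP.
  have -> : (fun y => (D (x - y))%:E * (rho y)%:E)%E =
      (fun y => (D (x - y) * (rho y - rho x))%:E + (D (x - y) * rho x)%:E)%E.
    by apply/funext => y; rewrite -EFinM -EFinD; congr (_%:E); ring.
  rewrite integralD//; under [X in (_ + X)%E]eq_integral do rewrite mulrC EFinM.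
  by rewrite integralZl// integral_odd// mule0 adde0.
rewrite /Rintegral E -/(Rintegral _ _ _).
apply: le_trans (le_normr_Rintegral _ _) _ => //.
apply: (@le_trans _ _ (\int[leb]_y (L * (C * e `^ alpha) * ind y))).
  apply: le_Rintegral => //; have := iDr => /integrable_abse.
  by apply: eq_integrable => // y _.
rewrite RintegralZl// /ind.
rewrite /Rintegral integral_indic// setIT [X in fine X]lebesgue_measure_ball//=.
by rewrite le_eqVlt; apply/orP; left; apply/eqP; ring.
Qed.

Lemma density_integrable_abs :
  (\int[leb]_x (x ^+ 2 * rho x)%:E < +oo)%E ->
  P.-integrable setT (fun y => `|y|%:E).
Proof.
move=> m2; have X2 : (\int[P]_y ((id y : R) ^+ 2)%:E < +oo)%E.
  rewrite ge0_integral_density//; last by move=> y; rewrite lee_fin sqr_ge0.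
  by apply/measurable_EFinP; exact: measurable_funX.
exact: integrable_abse (sqr_integrable1 _ X2).
Qed.

End holder_density.

(** * The Riesz kernel *)

Section riesz_profile.
Context {R : realType} (s : R).
Hypotheses (s_gt0 : 0 < s) (s_le1 : s <= 1).

Definition riesz_profile (r : R) :=
  if s == 2^-1 then - (pi^-1 * ln r) else c1 s * r `^ (2 * s - 1).

(** Coefficient of [r ^ (2 s - 2)] in the derivative of the profile; the logarithm fits the same
    form with exponent [-1]. *)
Definition riesz_slope := if s == 2^-1 then - pi^-1 else c1 s * (2 * s - 1).

Let euler_gamma_ge0 (x : R) : 0 <= euler_gamma x.
Proof.
by apply: Rintegral_ge0 => t _; rewrite mulr_ge0 ?powR_ge0 ?expR_ge0.
Qed.

Let c1_factor_ge0 : 0 <= s * 2 `^ (- (2 * s)) / (pi `^ 2^-1 * Gamma (1 + s)).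
Proof.
rewrite mulr_ge0 ?invr_ge0 ?mulr_ge0 ?powR_ge0// ?(ltW s_gt0)//.
by rewrite /Gamma ifT ?euler_gamma_ge0// addr_gt0.
Qed.

(* Only the sign of c1 matters, so neither the finiteness nor the positivity of
   Euler's integral is needed. *)
Lemma c1_ge0 : s < 2^-1 -> 0 <= c1 s.
Proof.
move=> s2; rewrite /c1 mulrAC mulr_ge0//.
by rewrite /Gamma subr_gt0 s2 euler_gamma_ge0.
Qed.

Lemma c1_le0 : 2^-1 < s -> c1 s <= 0.
Proof.
move=> s2; rewrite /c1 mulrAC mulr_ge0_le0// /Gamma subr_gt0 ltNge (ltW s2)/=.
(* [1/2 - s] lies in [[-1/2, 0[], so a single step of the functional equation is taken, and its
   division by [1/2 - s < 0] produces the sign. *)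
have -> : Num.truncn (- (2^-1 - s)) = 0%N.
  by apply/truncn0Pn; rewrite -ltNge; move: s_le1; lra.
by rewrite big_ord1 addr0 mulr_ge0_le0// invr_le0; lra.
Qed.

Lemma riesz_slope_le0 : riesz_slope <= 0.
Proof.
rewrite /riesz_slope; case: ifPn => [_|].
  by rewrite oppr_le0 invr_ge0 pi_ge0.
rewrite neq_lt => /orP[s2|s2].
  by rewrite mulr_ge0_le0 ?c1_ge0//; lra.
by rewrite mulr_le0_ge0 ?c1_le0//; lra.
Qed.

Lemma is_derive_riesz_profile (x : R) : 0 < x ->
  is_derive x 1 riesz_profile (riesz_slope * x `^ (2 * s - 2)).
Proof.
move=> x0; rewrite /riesz_profile /riesz_slope.
have [->|s2] := eqVneq s 2^-1.
  rewrite (_ : 2 * 2^-1 - 2 = -1 :> R); last lra.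
  rewrite powR_inv1 ?(ltW x0)//.
  have := is_derive1_ln x0 => d.
  have -> : - pi^-1 * x^-1 = - (pi^-1 *: x^-1) :> R by rewrite mulNr.
  exact: is_deriveN.
rewrite -mulrA (_ : 2 * s - 2 = 2 * s - 1 - 1); last by ring.
have := is_derive1_powR (2 * s - 1) x0 => d.
exact: is_deriveZ.
Qed.

Lemma riesz_profile_tangent (x y : R) : 0 < x -> 0 < y ->
  riesz_profile x + riesz_slope * x `^ (2 * s - 2) * (y - x) <= riesz_profile y.
Proof.
move=> x0 y0.
have b0 : 2 * s - 2 <= 0 by move: s_le1; lra.
have cont (u v : R) : 0 < u -> {within `[u, v], continuous riesz_profile}.
  move=> u0; apply: derivable_within_continuous => z; rewrite in_itv/= => /andP[uz _].
  by have [] := is_derive_riesz_profile (lt_le_trans u0 uz).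
have der (u v : R) : 0 < u -> forall z, z \in `]u, v[ ->
    is_derive z 1 riesz_profile (riesz_slope * z `^ (2 * s - 2)).
  move=> u0 z; rewrite in_itv/= => /andP[uz _].
  exact: is_derive_riesz_profile (lt_trans u0 uz).
have [xy|yx] := leP x y.
  have [c] := MVT_segment xy (der x y x0) (cont x y x0).
  rewrite in_itv/= => /andP[xc _] E.
  rewrite -lerBrDl E ler_wpM2r ?subr_ge0// ler_wnM2l ?riesz_slope_le0//.
  exact: nincr_powR.
have [c] := MVT_segment (ltW yx) (der y x y0) (cont y x y0).
rewrite in_itv/= => /andP[yc cx] E.
rewrite -lerBrDl -(opprB x y) mulrN lerNl opprB E.
rewrite ler_wpM2r ?subr_ge0 ?(ltW yx)// ler_wnM2l ?riesz_slope_le0//.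
apply: nincr_powR => //; exact: lt_le_trans y0 yc.
Qed.

Lemma measurable_W : measurable_fun setT (W s).
Proof.
rewrite /W; apply: measurable_fun_if => //.
  by apply: measurable_and => //; exact: measurable_fun_eqr.
apply: measurable_funTS; case: (s == 2^-1).
  apply/measurable_EFinP; apply: measurable_funN; apply: measurable_funM => //.
  exact: (measurableT_comp (@measurable_ln R)).
apply/measurable_EFinP; apply: measurable_funM => //.
exact: (measurableT_comp (measurable_powR _)).
Qed.

Lemma W_neq0 (x : R) : x != 0 -> W s x = (riesz_profile `|x|)%:E.
Proof.
move=> /negbTE x0; rewrite /W x0 andbF /riesz_profile.
by case: (s == 2^-1).
Qed.

Lemma W0_ge (e : R) : 0 < e ->
  ((tkernel riesz_profile riesz_slope (2 * s - 2) e 0)%:E <= W s 0)%E.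
Proof.
move=> e0; rewrite /W eqxx andbT; case: ifPn => [_|]; first by rewrite leey.
rewrite -ltNge => s2; rewrite gt_eqF// normr0 powR0; last by apply/eqP; lra.
rewrite mulr0 lee_fin /tkernel /tprofile normr0 (ltW e0).
rewrite /riesz_profile /riesz_slope gt_eqF// sub0r.
have -> : 2 * s - 2 = 2 * s - 1 - 1 by ring.
have p0 : 0 < 2 * s - 1 by lra.
have E := mulr_powRB1 (ltW e0) p0.
have h : c1 s * (2 * s - 1) * e `^ (2 * s - 1 - 1) * - e =
  - (c1 s * (2 * s - 1) * (e * e `^ (2 * s - 1 - 1))) by ring.
rewrite h E.
have := c1_le0 s2; have := powR_ge0 e (2 * s - 1).
move: (e `^ _) => t t0 c0.
(* The tangent at [e] takes the value [c1 s * e^(2 s - 1) * (2 - 2 s)] at 0, nonpositive as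
   [c1 s <= 0] and [s <= 1], whereas [W s 0 = 0]. *)
have -> : c1 s * t - c1 s * (2 * s - 1) * t = c1 s * (t * (2 - 2 * s)) by ring.
by rewrite mulr_le0_ge0// mulr_ge0//; move: s_le1; lra.
Qed.

End riesz_profile.

(** * The HWI inequality *)

Section mass_one.
Context d (T : measurableType d) (R : realType) (m : {measure set T -> \bar R}).

(* The proof argument lets the probability structure be inferred. *)
Definition mass_one (m1 : m setT = 1%E) : set T -> \bar R := m.

Context (m1 : m setT = 1%E).

HB.instance Definition _ := Measure.copy (mass_one m1) m.
HB.instance Definition _ :=
  @Measure_isProbability.Build _ _ R (mass_one m1) m1.

End mass_one.

(** The law of [(X, Y)] is an admissible coupling, and any other coupling is compared with it by
    regarding the projections [fst] and [snd] as random variables. *)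
Lemma W2_comonotone {R : realType} d (T : measurableType d)
    (P : probability T R) (mu nu : probability (measurableTypeR R) R)
    (X Y : T -> measurableTypeR R) :
  measurable_fun setT X -> measurable_fun setT Y ->
  (forall A, measurable A -> P (X @^-1` A) = mu A) ->
  (forall A, measurable A -> P (Y @^-1` A) = nu A) ->
  (forall u v, 0 <= ((X u : R) - X v) * ((Y u : R) - Y v)) ->
  W2 mu nu = sqrte (\int[P]_u (((X u : R) - Y u) ^+ 2)%:E)%E.
Proof.
move=> mX mY lX lY XY; rewrite /W2; congr sqrte.
have mdist : measurable_fun setT
    (fun z : measurableTypeR R * measurableTypeR R => (`|(z.1 : R) - z.2| ^+ 2)%:E).
  apply/measurable_EFinP; apply: measurable_funX; apply: measurableT_comp => //.
  exact: measurable_funB.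
have mXY : measurable_fun setT (fun u => (X u, Y u)) by exact: measurable_fun_pair.
apply/eqP; rewrite eq_le; apply/andP; split.
  apply: ereal_inf_lbound.
  exists (pushforward P (fun u => (X u, Y u))).
  - by split => A mA; rewrite /pushforward -?lX// -?lY.
  - rewrite ge0_integral_pushforward//.
    by apply: eq_integral => u _ /=; rewrite real_normK ?num_real.
apply/ereal_infP => _ [gam [gmu gnu] <-].
(* Couplings are mere measures; the first marginal fixes the total mass. *)
have gT : gam setT = 1%E.
  by rewrite -(preimage_setT fst) gmu// probability_setT.
pose Q : probability _ R := mass_one gT.
have := @comonotone_optimal _ _ _ _ R P Q (X : T -> R) (Y : T -> R) fst snd mX mY
  measurable_fst measurable_snd.
under [X in _ -> _ -> _ -> (_ <= X)%E]eq_integral do rewrite -real_normK ?num_real//.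
apply => // a.
- by rewrite lX// -gmu.
- by rewrite lY// -gnu.
Unshelve. all: exact: mXY.
Qed.

Section cauchy_schwarz.
Context d (T : measurableType d) (R : realType) (P : probability T R).
Variables f g : T -> R.
Hypotheses (mf : measurable_fun setT f) (mg : measurable_fun setT g).
Hypothesis f2 : (\int[P]_u (f u ^+ 2)%:E < +oo)%E.
Hypothesis g2 : (\int[P]_u (g u ^+ 2)%:E < +oo)%E.

Lemma sqr_integrableM : P.-integrable setT (fun u => (f u * g u)%:E).
Proof.
have ib : P.-integrable setT (fun u => (f u ^+ 2 + g u ^+ 2)%:E).
  under eq_fun do rewrite EFinD.
  by apply: integrableD => //; exact: sqr_integrable.
apply: le_integrable ib => //.
  by apply/measurable_EFinP; exact: measurable_funM.
move=> u _ /=; rewrite lee_fin [leRHS]ger0_norm ?addr_ge0 ?sqr_ge0//.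
have := sqr_ge0 (f u - g u); have := sqr_ge0 (f u + g u).
by rewrite ler_norml; nra.
Qed.

Lemma cauchy_schwarz_Rintegral :
  `|\int[P]_u (f u * g u)| <=
  Num.sqrt (\int[P]_u (f u ^+ 2)) * Num.sqrt (\int[P]_u (g u ^+ 2)).
Proof.
have if2 := sqr_integrable mf f2; have ig2 := sqr_integrable mg g2.
have ifg := sqr_integrableM.
set a := \int[P]_u (f u ^+ 2); set c := \int[P]_u (g u ^+ 2).
set b := \int[P]_u (f u * g u).
have quad t : 0 <= a * t ^+ 2 + 2 * b * t + c.
  have <- : \int[P]_u ((t * f u + g u) ^+ 2) = a * t ^+ 2 + 2 * b * t + c.
    rewrite (_ : (fun u => (t * f u + g u) ^+ 2) =
      (fun u => (t ^+ 2 * f u ^+ 2 + 2 * t * (f u * g u)) + g u ^+ 2)); last first.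
      by apply/funext => u; ring.
    have i1 : P.-integrable setT (EFin \o (fun u => t ^+ 2 * f u ^+ 2)).
      by rewrite /comp; under eq_fun do rewrite EFinM; exact: integrableZl.
    have i2 : P.-integrable setT (EFin \o (fun u => 2 * t * (f u * g u))).
      by rewrite /comp; under eq_fun do rewrite EFinM; exact: integrableZl.
    have i12 : P.-integrable setT
        (EFin \o (fun u => t ^+ 2 * f u ^+ 2 + 2 * t * (f u * g u))).
      by rewrite /comp; under eq_fun do rewrite EFinD; exact: integrableD.
    rewrite RintegralD// RintegralD// !RintegralZl//.
    by rewrite -/a -/b -/c; ring.
  by apply: Rintegral_ge0 => u _; exact: sqr_ge0.
have a0 : 0 <= a by apply: Rintegral_ge0 => u _; exact: sqr_ge0.
have c0 : 0 <= c by apply: Rintegral_ge0 => u _; exact: sqr_ge0.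
rewrite -sqrtrM// -sqrtr_sqr ler_wsqrtr//.
have [a00|a_neq0] := eqVneq a 0.
  suff -> : b = 0 by rewrite expr0n mulr_ge0.
  apply/eqP; apply: contraT => b_neq0.
  (* With [a = 0] the polynomial is affine in [t]; this [t] is where it takes the value [-1]. *)
  have := quad (- (c + 1) / (2 * b)); rewrite a00 mul0r add0r.
  rewrite (_ : _ + c = -1); last by field.
  lra.
have {}a_gt0 : 0 < a by rewrite lt_neqAle eq_sym a_neq0.
(* The minimum of the quadratic polynomial. *)
have := quad (- b / a).
rewrite (_ : _ + c = (a * c - b ^+ 2) / a); last by field.
by rewrite pmulr_lge0 ?invr_gt0// subr_ge0.
Qed.

End cauchy_schwarz.

Lemma sqrte_EFin {R : realType} (x : R) : sqrte x%:E = (Num.sqrt x)%:E.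
Proof. by []. Qed.

Unset Implicit Arguments.

Theorem theorem3p3 (R : realType) (s lambda alpha : R) (rho : R -> R)
    (s_gt0 : 0 < s) (s_le1 : s <= 1)
    (alpha_gt : Num.max (1 - 2 * s) 0 < alpha) (alpha_le1 : alpha <= 1)
    (rho_L1 : lebesgue_measure.-integrable [set: R] (EFin \o rho))
    (rho_Linf : finite_norm lebesgue_measure +oo%E rho)
    (rho_holder : holder_continuous alpha rho)
    (rho_ge0 : forall x, 0 <= rho x)
    (rho_mass : (\int[lebesgue_measure]_x (rho x)%:E = 1)%E)
    (rho_moment2 : (\int[lebesgue_measure]_x (x ^+ 2 * rho x)%:E < +oo)%E)
    (rho_inf : probability (measurableTypeR R) R)
    (rho_inf_min : is_energy_minimizer s lambda rho_inf) :
  let mu : probability (measurableTypeR R) R :=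
    density_prob rho_L1 rho_ge0 rho_mass in
  (energy s lambda mu - energy s lambda rho_inf <=
   sqrte (dissipation s lambda rho) * W2 mu rho_inf
   - (lambda / 2)%:E * W2 mu rho_inf ^+ 2)%E.
Proof.
pose mu : probability (measurableTypeR R) R :=
  density_prob rho_L1 rho_ge0 rho_mass.
lazy zeta; rewrite -/mu.
have [alpha_gt1 alpha_gt0] : 1 - 2 * s < alpha /\ 0 < alpha.
  by apply/andP; rewrite -gt_max.
have [C0 holder0] := rho_holder.
have C_ge0 : 0 <= `|C0| by [].
have holder x y : `|rho x - rho y| <= `|C0| * `|x - y| `^ alpha.
  by apply: le_trans (holder0 x y) _; rewrite ler_wpM2r ?powR_ge0 ?ler_norm.
pose k := riesz_profile s; pose kap := riesz_slope s; pose b := 2 * s - 2.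
have kap_le0 : kap <= 0 := riesz_slope_le0 s_gt0 s_le1.
have b_le0 : b <= 0 by rewrite /b; lra.
have b_gtN2 : -2 < b by rewrite /b; lra.
have alpha_b : 0 < b + alpha + 1 by rewrite /b; lra.
have tangent := riesz_profile_tangent s_gt0 s_le1.
have M_ge0 : 0 <= (1 + `|C0|) * 2 by rewrite mulr_ge0// addr_ge0.
have mu_abs := density_integrable_abs rho_L1 rho_ge0 rho_mass rho_moment2.
have mu_ball := holder_density_ball rho_L1 rho_ge0 rho_mass (ltW alpha_gt0) C_ge0 holder.
have mu_odd := holder_density_odd rho_L1 rho_ge0 rho_mass (ltW alpha_gt0) C_ge0 holder.
have C2_ge0 : 0 <= 2 * `|C0| by rewrite mulr_ge0.
pose X := quantile_rv mu; pose Y := quantile_rv rho_inf.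
pose P : probability (measurableTypeR R) R := @uniform01 R.
have mX : measurable_fun setT X := measurable_quantile_rv mu.
have mY : measurable_fun setT Y := measurable_quantile_rv rho_inf.
have lX A : measurable A -> P (X @^-1` A) = mu A by exact: quantile_law.
have lY A : measurable A -> P (Y @^-1` A) = rho_inf A by exact: quantile_law.
have XY u v : 0 <= ((X u : R) - X v) * ((Y u : R) - Y v).
  exact: quantile_rv_comonotone.
have msqr : measurable_fun setT (fun x : measurableTypeR R => ((x : R) ^+ 2)%:E).
  by apply/measurable_EFinP; exact: measurable_funX.
have EX2 : (\int[mu]_x (x ^+ 2)%:E = \int[P]_u ((X u : R) ^+ 2)%:E)%E.
  exact: (integral_law mX lX msqr).
have EY2 : (\int[rho_inf]_x (x ^+ 2)%:E = \int[P]_u ((Y u : R) ^+ 2)%:E)%E.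
  exact: (integral_law mY lY msqr).
have X2 : (\int[P]_u ((X u : R) ^+ 2)%:E < +oo)%E.
  rewrite -EX2 ge0_integral_density//; last by move=> x; rewrite lee_fin sqr_ge0.
have Y2 : (\int[P]_u ((Y u : R) ^+ 2)%:E < +oo)%E.
  by rewrite -EY2; exact: rho_inf_min.1.
have iX2 := sqr_integrable mX X2; have iY2 := sqr_integrable mY Y2.
have iX := sqr_integrable1 mX X2; have iY := sqr_integrable1 mY Y2.
pose U := limpotential k kap b mu.
pose V := limpotential' kap b mu.
have dU (x : R) : is_derive x 1 U (V x).
  exact: (limpotential_is_derive kap_le0 b_le0 tangent mu_abs M_ge0 mu_ball
    C2_ge0 mu_odd b_gtN2 alpha_b).
have mWs := measurable_W s.
have Ws_neq0 := @W_neq0 R s.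
have Ws0 := @W0_ge R s s_gt0 s_le1.
have WE x : (\int[mu]_y W s (x - y) = (U x)%:E)%E.
  exact: (integral_W kap_le0 b_le0 tangent mu_abs M_ge0 mu_ball b_gtN2 mWs Ws_neq0 Ws0).
have potentialE : potential s rho = U.
  apply/funext => x; rewrite /potential.
  have mWx : measurable_fun setT (fun y : measurableTypeR R => W s (x - y)).
    by apply: (measurableT_comp mWs); exact: measurable_funB.
  by rewrite -(integral_density rho_L1 rho_ge0 rho_mass mWx) WE.
have derE x : derive1 (potential s rho) x = V x.
  by rewrite potentialE derive1E; have [] := dU x.
have mV : measurable_fun setT V by exact: measurable_is_derive dU.
have [B VB] : exists B, forall x, `|V x| <= B.
  by eexists => x; exact: (limpotential'_bounded kap_le0 b_le0 C2_ge0 mu_odd alpha_b).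
pose f (u : measurableTypeR R) : R := V (X u) + lambda * X u.
pose g (u : measurableTypeR R) : R := (Y u : R) - X u.
have mf : measurable_fun setT f.
  by apply: measurable_funD; [exact: (measurableT_comp mV mX)|exact: measurable_funM].
have mg : measurable_fun setT g by exact: measurable_funB.
have iaX (a c : R) : P.-integrable setT
    (EFin \o (fun u : measurableTypeR R => a + c * (X u : R) ^+ 2)).
  rewrite /comp; under eq_fun do rewrite EFinD EFinM.
  apply: integrableD => //; last exact: integrableZl.
  exact: (finite_measure_integrable_cst P _ measurableT).
have f2 : (\int[P]_u (f u ^+ 2)%:E < +oo)%E.
  apply: (sqr_lty mf (iaX (2 * B ^+ 2) (2 * lambda ^+ 2))).
  move=> u; have VB2 : V (X u) ^+ 2 <= B ^+ 2.
    rewrite -real_normK ?num_real// lerXn2r ?nnegrE//.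
    exact: le_trans (VB (X u)).
  have := sqr_ge0 (V (X u) - lambda * X u); rewrite /f.
  move: VB2; set v := V _; set x := X u; nra.
have g2 : (\int[P]_u (g u ^+ 2)%:E < +oo)%E.
  have iXY : P.-integrable setT
      (EFin \o (fun u : measurableTypeR R => 2 * (X u : R) ^+ 2 + 2 * (Y u : R) ^+ 2)).
    rewrite /comp; under eq_fun do rewrite EFinD !EFinM.
    by apply: integrableD => //; exact: integrableZl.
  apply: (sqr_lty mg iXY).
  move=> u; have := sqr_ge0 ((Y u : R) + X u); rewrite /g.
  set x := (X u : R); set y := (Y u : R); nra.
have CS := cauchy_schwarz_Rintegral mf mg f2 g2.
have if2 := sqr_integrable mf f2; have ig2 := sqr_integrable mg g2.
set dd := \int[P]_u (f u ^+ 2) in CS; set ww := \int[P]_u (g u ^+ 2) in CS.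
have dissE : dissipation s lambda rho = dd%:E.
  rewrite /dd /Rintegral fineK; last by apply: integrable_fin_num.
  rewrite /dissipation.
  have mh : measurable_fun setT
      (fun x : measurableTypeR R => ((V x + lambda * x) ^+ 2)%:E).
    apply/measurable_EFinP; apply: measurable_funX.
    by apply: measurable_funD; [exact: mV|exact: measurable_funM].
  rewrite -(integral_law mX lX mh) (integral_density rho_L1 rho_ge0 rho_mass mh).
  apply: eq_integral => x _; rewrite derE real_normK ?num_real//.
have ww_ge0 : 0 <= ww by apply: Rintegral_ge0 => u _; exact: sqr_ge0.
have W2E : W2 mu rho_inf = (Num.sqrt ww)%:E.
  rewrite (W2_comonotone mX mY lX lY XY) /ww /Rintegral -sqrte_EFin fineK; last first.
    by apply: integrable_fin_num.
  by congr sqrte; apply: eq_integral => u _; rewrite /g -sqrrN opprB.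
have interE : (\int[mu \x mu]_z W s ((z.1 : R) - z.2) = (\int[P]_u U (X u))%:E)%E.
  exact: (interaction_limpotential kap_le0 b_le0 tangent mu_abs M_ge0 mu_ball
    C2_ge0 mu_odd b_gtN2 alpha_b mWs Ws_neq0 Ws0 mX lX iX).
have main : ((\int[P]_u U (X u) + 2 * \int[P]_u (V (X u) * g u))%:E <=
    \int[rho_inf \x rho_inf]_z W s ((z.1 : R) - z.2))%E.
  exact: (comonotone_interaction kap_le0 b_le0 tangent mu_abs M_ge0 mu_ball
    C2_ge0 mu_odd b_gtN2 alpha_b mWs Ws_neq0 Ws0 mX mY lX lY iX iY XY).
set N := \int[P]_u (V (X u) * g u) in main.
set A := \int[P]_u U (X u) in interE main.
have ifg := sqr_integrableM mf mg f2 g2.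
have iXg := sqr_integrableM mX mg X2 g2.
have iVg : P.-integrable setT (EFin \o (fun u : measurableTypeR R => V (X u) * g u)).
  have := integrableB measurableT ifg (integrableZl measurableT lambda iXg).
  apply: eq_integrable => // u _; rewrite /=; congr (_%:E).
  by rewrite /f; ring.
have fgE : \int[P]_u (f u * g u) = N + lambda * \int[P]_u ((X u : R) * g u).
  rewrite -RintegralZl// -RintegralD//.
    by apply: eq_Rintegral => u _; rewrite /f; ring.
  by rewrite /comp; under eq_fun do rewrite EFinM; exact: integrableZl.
(* The confinement expanded around [X]: its linear term completes [N] to the integral of [f * g],
   and [ww] is the squared distance. *)
have YE : \int[P]_u ((Y u : R) ^+ 2) =
    \int[P]_u ((X u : R) ^+ 2) + 2 * \int[P]_u ((X u : R) * g u) + ww.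
  have i1 : P.-integrable setT (EFin \o (fun u : measurableTypeR R => 2 * ((X u : R) * g u))).
    by rewrite /comp; under eq_fun do rewrite EFinM; exact: integrableZl.
  rewrite /ww -RintegralZl// -RintegralD// -RintegralD//.
    by apply: eq_Rintegral => u _; rewrite /g; ring.
  by rewrite /comp; under eq_fun do rewrite EFinD; exact: integrableD.
rewrite dissE W2E sqrte_EFin /energy interE EX2 EY2.
have -> : (\int[P]_u ((X u : R) ^+ 2)%:E = (\int[P]_u ((X u : R) ^+ 2))%:E)%E.
  by rewrite /Rintegral fineK//; apply: integrable_fin_num.
have -> : (\int[P]_u ((Y u : R) ^+ 2)%:E = (\int[P]_u ((Y u : R) ^+ 2))%:E)%E.
  by rewrite /Rintegral fineK//; apply: integrable_fin_num.
(* An interaction energy [+oo] of [rho_inf] makes the left-hand side [-oo], and [main] excludes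
   [-oo]. *)
case: (\int[rho_inf \x rho_inf]_z W s ((z.1 : R) - z.2))%E main => [r| |] main.
- rewrite -EFin_expe -!(EFinM, EFinD, EFinN, EFinB) lee_fin.
  rewrite sqr_sqrtr// YE.
  move: main CS; rewrite fgE lee_fin ler_norml => main /andP[CS _].
  (* Half of [main] bounds the energy gap by minus the integral of [f * g] minus [lambda / 2 * ww],
     and [CS] bounds the first of these terms. *)
  nra.
- by rewrite mulry gtr0_sg ?invr_gt0// mul1e addye//= addeNy leNye.
- by move: main; rewrite leeNy_eq.
Qed.
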